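(* Let $1\le p\le\infty$ and $\mu_0\in\mathcal{M}$. The following convergence conditions as $\mu\to\mu_0$ in the metric space $\mathcal{M}$ are equivalent: (I) $A_{r-\ell}(\cdot,\mu)\to A_{r-\ell}(\cdot,\mu_0)$ in the Banach space $(W^n_p)^{m\times m}$ for all $\ell\in\{1,\ldots,r\}$; (II) $L(\mu)\to L(\mu_0)$ in the uniform operator topology (i.e. in the norm of bounded linear operators from $(W^{n+r}_p)^m$ to $(W^n_p)^m$); (III) $L(\mu)\to L(\mu_0)$ in the strong operator topology (i.e. $L(\mu)y\to L(\mu_0)y$ in $(W^n_p)^m$ for every $y\in(W^{n+r}_p)^m$).
   Context: Let $(a,b)\subset\mathbb{R}$ be a finite interval, $n\in\mathbb{N}\cup\{0\}$, $m,r\in\mathbb{N}=\{1,2,\ldots\}$. $W^{k}_p=W^k_p([a,b];\mathbb{C})$ is the complex Sobolev space with norm $\|y\|_{k,p}=\sum_{s=0}^{k}\|y^{(s)}\|_{L_p}$, and $W^0_p=L_p$. $(W^k_p)^m$ and $(W^k_p)^{m\times m}$ denote the spaces of $\mathbb{C}^m$-valued (column) and $\mathbb{C}^{m\times m}$-valued functions with all entries in $W^k_p$; their norms are the sums of the norms of the entries. $\mathcal{M}$ is an arbitrary metric space. For each $\mu\in\mathcal{M}$ there are given arbitrary matrix-valued functions $A_{r-\ell}(\cdot,\mu)\in(W^n_p)^{m\times m}$, $\ell=1,\ldots,r$, and $L(\mu)\colon(W^{n+r}_p)^m\to(W^n_p)^m$ is the continuous linear operator $L(\mu)y:=y^{(r)}+\sum_{\ell=1}^r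 A_{r-\ell}(\cdot,\mu)\,y^{(r-\ell)}$. *)

(* Defs.v *)
From HB Require Import structures.
From mathcomp Require Import all_boot all_order all_algebra.
From mathcomp Require Import all_classical all_reals all_analysis.
From mathcomp Require Import complex.

Set Implicit Arguments.
Unset Strict Implicit.
Unset Printing Implicit Defensive.

Import Order.TTheory GRing.Theory Num.Theory.
Import numFieldNormedType.Exports.

Local Open Scope classical_set_scope.
Local Open Scope ring_scope.
Local Open Scope complex_scope.

(* Functions on the finite interval are represented by total functions on R of
   which only the values on the open interval ]a, b[ are used. An element of
   L_p is represented by any function of its class; an element of W^k_p,
   k >= 1, by a function whose restriction to ]a, b[ is its C^(k-1)
   representative. Nothing is lost by leaving out a and b: an absolutely
   continuous function on ]a, b[ extends continuously to [a, b], hence so do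
   its successive primitives, with one-sided derivatives at a and b. *)

Definition reC (R : realType) (f : R -> R[i]) : R -> R :=
  fun x => complex.Re (f x).

Definition imC (R : realType) (f : R -> R[i]) : R -> R :=
  fun x => complex.Im (f x).

(* The derivative of a complex function of a real variable is taken
   componentwise. As the operation [derive1n] of the library, it is total: its
   value is arbitrary where the derivative does not exist. *)
Definition cderivn (R : realType) (s : nat) (f : R -> R[i]) : R -> R[i] :=
  fun x => derive1n s (reC f) x +i* derive1n s (imC f) x.

Definition cderivable (R : realType) (f : R -> R[i]) (x : R) : Prop :=
  derivable (reC f) x 1 /\ derivable (imC f) x 1.

Definition abs_continuous (R : realType) (a b : R) (f : R -> R[i]) : Prop :=
  forall e : R, 0 < e -> exists2 d : R, 0 < d &
    forall (N : nat) (u v : 'I_N -> R),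
      (forall i, [/\ a < u i, u i <= v i & v i < b]) ->
      trivIset [set: 'I_N] (fun i => [set` `]u i, v i[]) ->
      \sum_(i < N) (v i - u i) < d ->
      \sum_(i < N) Normc.normc (f (v i) - f (u i)) < e.

(* Lebesgue measurability of f on ]a, b[. The sigma-algebra that the library
   puts on R is the Borel one, so that f is only required to agree almost
   everywhere with a Borel function. *)
Definition Lebesgue_measurable (R : realType) (a b : R) (f : R -> R[i]) : Prop :=
  exists g : R -> R[i],
    [/\ measurable_fun `]a, b[ (reC g), measurable_fun `]a, b[ (imC g) &
        {ae lebesgue_measure, forall x, x \in `]a, b[ -> f x = g x}].

Definition Lpnorm (R : realType) (a b : R) (p : \bar R) (f : R -> R[i])
    : \bar R :=
  'N[lebesgue_measure]_p[(fun x => (Normc.normc (f x))%:E) \_ `]a, b[]%E.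

Definition Lp (R : realType) (a b : R) (p : \bar R) (f : R -> R[i]) : Prop :=
  Lebesgue_measurable a b f /\ (Lpnorm a b p f < +oo)%E.

(* For k >= 1, W^k_p consists of the y in C^(k-1) with y^(k-1) absolutely
   continuous and y^(k) in L_p; continuity of y^(s) for s < k is implied by
   differentiability for s < k - 1 and by absolute continuity for s = k - 1. *)
Definition Sobolev (R : realType) (a b : R) (k : nat) (p : \bar R)
    (y : R -> R[i]) : Prop :=
  match k with
  | 0 => Lp a b p y
  | k'.+1 =>
    [/\ forall s : nat, (s < k')%N ->
          forall x : R, x \in `]a, b[ -> cderivable (cderivn s y) x,
        abs_continuous a b (cderivn k' y) &
        Lp a b p (cderivn k y)]
  end.

Definition Sobolev_norm (R : realType) (a b : R) (k : nat) (p : \bar R)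
    (y : R -> R[i]) : \bar R :=
  (\sum_(s < k.+1) Lpnorm a b p (cderivn s y))%E.

(* (W^k_p)^(m x q); column vectors are the case q = 1. *)
Definition mxSobolev (R : realType) (a b : R) (k : nat) (p : \bar R)
    (m q : nat) (y : R -> 'M[R[i]]_(m, q)) : Prop :=
  forall i j, Sobolev a b k p (fun x => y x i j).

Definition mxSobolev_norm (R : realType) (a b : R) (k : nat) (p : \bar R)
    (m q : nat) (y : R -> 'M[R[i]]_(m, q)) : \bar R :=
  (\sum_(i < m) \sum_(j < q) Sobolev_norm a b k p (fun x => y x i j))%E.

Definition mxderivn (R : realType) (s m q : nat) (y : R -> 'M[R[i]]_(m, q))
    : R -> 'M[R[i]]_(m, q) :=
  fun x => \matrix_(i, j) cderivn s (fun t => y t i j) x.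

(* L y = y^(r) + \sum_(1 <= l <= r) A_(r-l) y^(r-l), the sum being indexed by
   j = r - l. *)
Definition diff_op (R : realType) (m r : nat) (A : 'I_r -> R -> 'M[R[i]]_m)
    (y : R -> 'cV[R[i]]_m) : R -> 'cV[R[i]]_m :=
  fun x => mxderivn r y x + \sum_(j < r) A j x *m mxderivn j y x.

(* Norm of T as an operator from (W^k_p)^m to (W^l_p)^m, +oo if T is not
   bounded. *)
Definition op_norm (R : realType) (a b : R) (k l : nat) (p : \bar R) (m : nat)
    (T : (R -> 'cV[R[i]]_m) -> R -> 'cV[R[i]]_m) : \bar R :=
  ereal_sup [set mxSobolev_norm a b l p (T y) | y in
    [set y : R -> 'cV[R[i]]_m |
      mxSobolev a b k p y /\ (mxSobolev_norm a b k p y <= 1)%E]].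

(* Main.v *)
Require Import Defs.
From HB Require Import structures.
From mathcomp Require Import all_boot all_order all_algebra.
From mathcomp Require Import all_classical all_reals all_analysis.
From mathcomp Require Import measurable_realfun ess_sup_inf complex ring lra.

(* (I) => (II) and (II) => (III) rest on Leibniz' formula and on the embedding of
   W^1_p into bounded functions, which bounds the derivatives of y of order
   < n + r by a multiple of its norm. The embedding and the differentiability
   almost everywhere of the derivative of order n - 1 come from the fundamental
   theorem of calculus for absolutely continuous functions: the total variation
   V of such an f is absolutely continuous, so the Lebesgue-Stieltjes measures of
   the nondecreasing functions V and V - f have Radon-Nikodym densities with
   respect to Lebesgue measure, and Lebesgue's differentiation theorem applies to
   them.

   (III) => (I): testing on y = x^s / s! e_k gives column k of A_s plus the
   products of the columns of A_j, j < s, with x^(s-j) / (s-j)!; the convergence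
   of A_s follows by strong induction on s. *)

Set Implicit Arguments.
Unset Strict Implicit.
Unset Printing Implicit Defensive.

Import Order.TTheory GRing.Theory Num.Theory.
Import numFieldNormedType.Exports.

Local Open Scope classical_set_scope.
Local Open Scope ring_scope.
Local Open Scope complex_scope.

(** * Absolutely continuous functions and total variation *)

(** In [L(mu) - L(mu0)] the leading terms [y^(r)] cancel. Hence, after n further differentiations,
    only derivatives of y of order at most n + r - 1 occur, and these are exactly the orders that
    the embedding bounds.

    Two obstacles shape the proof. First, a Sobolev function is a total function of which only the
    values on []a, b[] count; its top derivative exists only almost everywhere and is only almost
    everywhere equal to a Borel function. Derivatives of sums and products therefore cannot be
    rewritten as equalities of functions. Estimates are made on jets, sequences of explicitly given
    derivatives, and compared with [cderivn] only at the end. Second, absolute continuity is given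
    on the open interval, without boundary values. The results on functions on the whole line are
    applied to f clamped to some [[c, d]] inside []a, b[], and countably many such segments exhaust
    []a, b[].

    All constants K are chosen before A and B, so each implication is a squeeze between norms. *)

Definition interval_family (R : realType) (s : seq (R * R)) : bool :=
  all (fun I => I.1 <= I.2) s &&
  pairwise (fun I J => (I.2 <= J.1) || (J.2 <= I.1)) s.

(* Families are lists rather than functions on ordinals, so that an interval of
   a family can be replaced by the intervals of a partition of it. *)
Definition ac_function (R : realType) (f : R -> R) : Prop :=
  forall e : R, 0 < e -> exists2 d : R, 0 < d &
    forall s, interval_family s -> \sum_(I <- s) (I.2 - I.1) < d ->
      \sum_(I <- s) `|f I.2 - f I.1| < e.

(** In [itv_partition] the list t omits the left endpoint u and ends with the right one; [zip] drops
    the surplus last entry of [u :: t]. *)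
Definition partition_intervals (R : realType) (u : R) (t : seq R) :=
  [seq (x.2, x.1) | x <- zip t (u :: t)].

Lemma partition_intervals_bounds (R : realType) (u v : R) t :
  itv_partition u v t ->
  all (fun I => [&& u <= I.1, I.1 <= I.2 & I.2 <= v]) (partition_intervals u t).
Proof.
elim: t u => [//|h t IH] u Huv.
have Hhv := itv_partition_cons Huv.
have uh : u <= h by case: Huv => /= /andP[/ltW].
rewrite /partition_intervals /= lexx uh (itv_partition_le Hhv) /=.
apply: sub_all (IH _ Hhv) => I /and3P[hI -> ->].
by rewrite (le_trans uh hI).
Qed.

Lemma interval_family_partition (R : realType) (u v : R) t :
  itv_partition u v t -> interval_family (partition_intervals u t).
Proof.
move=> Huv; apply/andP; split.
  by apply: sub_all (partition_intervals_bounds Huv) => I /and3P[].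
elim: t u Huv => [//|h t IH] u Huv.
have Hhv := itv_partition_cons Huv.
rewrite /partition_intervals /= IH // andbT.
by apply: sub_all (partition_intervals_bounds Hhv) => I /and3P[-> _ _].
Qed.

Lemma partition_intervals_length (R : realType) (u v : R) t :
  itv_partition u v t ->
  \sum_(I <- partition_intervals u t) (I.2 - I.1) = v - u.
Proof.
elim: t u => [|h t IH] u Huv.
  by rewrite (itv_partition_nil Huv) big_nil subrr.
rewrite big_cons /= -/(partition_intervals h t) (IH _ (itv_partition_cons Huv)).
by rewrite addrC addrA subrK.
Qed.

Lemma partition_intervals_variation (R : realType) (u v : R) f t :
  itv_partition u v t ->
  \sum_(I <- partition_intervals u t) `|f I.2 - f I.1| = variation u v f t.
Proof. by move=> Huv; rewrite (variation_zip _ Huv) big_map. Qed.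

(** The separation of two intervals is symmetric in them, so the order of the list is immaterial and
    the pieces of I may be placed behind s1. *)
Lemma interval_family_refine (R : realType) (I : R * R) t s1 s2 :
  itv_partition I.1 I.2 t -> interval_family ((I :: s1) ++ s2) ->
  interval_family (s1 ++ (partition_intervals I.1 t ++ s2)).
Proof.
move=> HI /andP[] /=; rewrite !all_cat !pairwise_cat.
move=> /and3P[_ a1 a2] /andP[I12 /and3P[r12 p1 p2]].
have bL := partition_intervals_bounds HI.
have /andP[aL pL] := interval_family_partition HI.
apply/andP; rewrite !all_cat !pairwise_cat a1 a2 aL p1 p2 pL /= andbT.
split=> //.
(* A piece K of I lies on the same side of J as I does. *)
have IL J K : ((I.2 <= J.1) || (J.2 <= I.1)) ->
    [&& I.1 <= K.1, K.1 <= K.2 & K.2 <= I.2] ->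
    (K.2 <= J.1) || (J.2 <= K.1).
  move=> /orP[h|h] /and3P[h1 h2 h3]; apply/orP; [left|right].
    exact: le_trans h.
  exact: le_trans h1.
case/andP: I12 => I1 I2.
rewrite allrel_catr r12 andbT /=; apply/andP; split.
  apply/allrelP => J K Js KL; rewrite orbC.
  apply: IL; [exact: (allP I1)|exact: (allP bL)].
apply/allrelP => K J KL Js.
by apply: IL; [exact: (allP I2)|exact: (allP bL)].
Qed.

(* By induction on s1: the total variation over an interval of s1 is the supremum
   of the sums over its partitions, which are moved to s2. *)
Lemma total_variation_family (R : realType) (f : R -> R) (d e : R) :
  (forall u v : R, u <= v -> total_variation u v f \is a fin_num) ->
  (forall s, interval_family s -> \sum_(I <- s) (I.2 - I.1) < d ->
      \sum_(I <- s) `|f I.2 - f I.1| < e) ->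
  forall s1 s2, interval_family (s1 ++ s2) ->
    \sum_(I <- s1 ++ s2) (I.2 - I.1) < d ->
    \sum_(I <- s1) fine (total_variation I.1 I.2 f) +
    \sum_(I <- s2) `|f I.2 - f I.1| <= e.
Proof.
move=> TVfin fde; elim=> [|I s1 IH] s2 Hs sd.
  by rewrite big_nil add0r ltW // fde.
have I12 : I.1 <= I.2 by case/andP: Hs => /= /andP[].
rewrite big_cons -addrA -lerBrDr -lee_fin fineK; last exact: TVfin.
apply: ge_ereal_sup => _ [_ [t Ht <-] <-].
rewrite lee_fin lerBrDr.
rewrite -(partition_intervals_variation f Ht) addrCA -big_cat.
apply: IH; first exact: interval_family_refine Ht Hs.
rewrite !big_cat /= (partition_intervals_length Ht).
by move: sd; rewrite /= big_cons big_cat /= addrCA.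
Qed.

(** With d the modulus for e = 1, the variation over a segment of length at most d / 2 is at most 1.
    Finitely many such segments cover [[u, v]], and total variation is additive. *)
Lemma ac_function_total_variation (R : realType) (f : R -> R) (u v : R) :
  ac_function f -> u <= v -> total_variation u v f \is a fin_num.
Proof.
move=> /(_ 1 ltr01)[d d0 fd] uv.
have short x y : x <= y -> y <= x + d / 2 -> (total_variation x y f < +oo)%E.
  move=> xy yx; apply: le_lt_trans (ltry 1); apply: ge_ereal_sup.
  move=> _ [_ [t Ht <-] <-]; rewrite lee_fin -(partition_intervals_variation f Ht).
  apply/ltW/fd; first exact: interval_family_partition Ht.
  by rewrite (partition_intervals_length Ht); lra.
rewrite ge0_fin_numE ?total_variation_ge0 //.
have [k] : exists k : nat, v <= u + k%:R * (d / 2).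
  exists (Num.bound ((v - u) / (d / 2))).
  rewrite -lerBlDl -ler_pdivrMr; last lra.
  by apply/ltW/archi_boundP; rewrite divr_ge0 //; lra.
elim: k u uv => [|k IH] u uv.
  by rewrite mul0r addr0 => vu; apply: short => //; lra.
move=> vk; have [|uv'] := leP v (u + d / 2); first exact: short.
rewrite (@total_variationD _ _ _ (u + d / 2)); [|lra|lra].
apply: lte_add_pinfty; first by apply: short; lra.
by apply: IH; move: vk; rewrite -natr1 mulrDl mul1r; lra.
Qed.

Lemma ac_function_continuous (R : realType) (f : R -> R) :
  ac_function f -> continuous f.
Proof.
move=> fac x; apply/cvgrPdist_lt => e e0.
have [d d0 fd] := fac e e0.
near=> y.
have xy : `|x - y| < d by near: y; apply: (@cvgr_dist_lt _ R^o).
have small u v : u <= v -> v - u < d -> `|f v - f u| < e.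
  move=> uv vud; have := fd [:: (u, v)]; rewrite !big_seq1 /=; apply => //.
  by rewrite /interval_family /= uv.
have [h|h] := leP y x.
  by apply: small => //; rewrite ger0_norm ?subr_ge0 in xy.
rewrite distrC; apply: small; first exact: ltW.
by rewrite distrC ger0_norm ?subr_ge0 ?ltW in xy.
Unshelve. all: by end_near. Qed.

Lemma interval_family_map (R : realType) (g : R -> R) s :
  {homo g : x y / x <= y} -> interval_family s ->
  interval_family [seq (g J.1, g J.2) | J <- s].
Proof.
move=> gnd /andP[a p]; apply/andP; split.
  by rewrite all_map; apply: sub_all a => I /= /gnd.
rewrite pairwise_map; apply: sub_pairwise p => I J /= /orP[|] /gnd -> //.
by rewrite orbT.
Qed.

(** The increment of this function over an interval is the total variation over the clamped
    interval, and clamping does not lengthen intervals. [total_variation_family] with empty s2 then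
    applies; the modulus for e / 2 makes up for its non-strict bound. *)
Lemma ac_function_total_variation_max (R : realType) (c : R) (f : R -> R) :
  ac_function f ->
  ac_function (fun x => fine (total_variation c (Order.max c x) f)).
Proof.
move=> fac e e0; have e20 : 0 < e / 2 by lra.
have [d d0 fd] := fac _ e20; exists d => // s Hs sd.
have TVfin u v : u <= v -> total_variation u v f \is a fin_num.
  exact: ac_function_total_variation.
pose g := fun x => Order.max c x.
have gnd : {homo g : x y / x <= y}.
  move=> x y xy; rewrite /g ge_max le_max lexx /=.
  by rewrite le_max xy orbT.
have Hgs := interval_family_map gnd Hs.
have gsd : \sum_(I <- [seq (g J.1, g J.2) | J <- s]) (I.2 - I.1) < d.
  apply: le_lt_trans sd; rewrite big_map /= big_seq [leRHS]big_seq.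
  apply: ler_sum => I sI; case/andP: Hs => /allP /(_ _ sI) /= I12 _.
  by rewrite /g; case: (leP c I.1); case: (leP c I.2) => h1 h2; lra.
have := @total_variation_family _ f d _ TVfin fd [seq (g J.1, g J.2) | J <- s] [::].
rewrite cats0 => /(_ Hgs gsd); rewrite big_nil addr0 big_map /= => tve.
apply: (@le_lt_trans _ _ (e / 2)); last lra.
apply: le_trans tve; rewrite le_eqVlt; apply/orP; left; apply/eqP.
rewrite big_seq [RHS]big_seq.
apply: eq_bigr => I sI; case/andP: Hs => /allP /(_ _ sI) /= I12 _.
have cg x : c <= g x by rewrite /g le_max lexx.
rewrite -/(g I.2) -/(g I.1) (total_variationD _ (cg I.1) (gnd _ _ I12)).
rewrite fineD ?TVfin ?gnd //= addrC addKr ger0_norm //.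
by rewrite fine_ge0 // total_variation_ge0 // gnd.
Qed.

Lemma ac_functionB (R : realType) (f g : R -> R) :
  ac_function f -> ac_function g -> ac_function (fun x => f x - g x).
Proof.
move=> fac gac e e0; have e20 : 0 < e / 2 by lra.
have [d d0 fd] := fac _ e20; have [d' d'0 gd] := gac _ e20.
exists (Order.min d d'); first by rewrite lt_min d0.
move=> s Hs; rewrite lt_min => /andP[sd sd'].
have := ltrD (fd _ Hs sd) (gd _ Hs sd').
rewrite -splitr -big_split /=; apply: le_lt_trans.
apply: ler_sum => I _; apply: le_trans (ler_normB _ _).
by rewrite le_eqVlt; apply/orP; left; apply/eqP; congr (`| _ |); lra.
Qed.

(** * Densities of absolutely continuous functions *)

Lemma lebesgue_stieltjes_itv (R : realType) (F : cumulative R R) (u v : R) :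
  u <= v -> lebesgue_stieltjes_measure F `]u, v] = (F v - F u)%:E.
Proof.
move=> uv; rewrite /lebesgue_stieltjes_measure /measure_extension /=.
by rewrite measurable_mu_extE /=; [rewrite wlength_itv_bnd|exact: is_ocitv].
Qed.

Lemma open_interval_finite_measure (R : realType) (A : set R) :
  is_interval A -> open A -> A !=set0 -> (lebesgue_measure A < +oo)%E ->
  exists u v : R, u < v /\ A = `]u, v[%classic.
Proof.
move=> /is_intervalP iA oA A0 Afin.
(* The hull may be recorded with closed ends; passing to interiors, which does not change the open
   set A, opens them. *)
have {oA} : A = A° by exact/esym/interior_id.
move: Afin A0; rewrite {}iA; case: (Rhull A) => [[bu u|[|]] [bv v|[|]]].
- rewrite interior_itv_bnd => _ [x Ax] E; exists u, v; split=> //.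
  by move: Ax; rewrite E /= in_itv /= => /andP[] /lt_trans; exact.
- by move=> _ [x]; rewrite /= in_itv /= andbF.
- by rewrite lebesgue_measure_itv /= ltry.
- by rewrite lebesgue_measure_itv /= ltNyr.
- by move=> _ [x]; rewrite /= in_itv.
- by rewrite lebesgue_measure_itv.
- by move=> _ [x]; rewrite /= in_itv.
- by move=> _ [x]; rewrite /= in_itv.
- by move=> _ [x]; rewrite /= in_itv.
Qed.

(** A null set lies in an open U of Lebesgue measure below the modulus d. U is a countable disjoint
    union of open intervals; absolute continuity bounds the F-measure of every finite subfamily by
    e, hence that of U. *)
Lemma lebesgue_stieltjes_dominates (R : realType) (F : cumulative R R) :
  ac_function F -> lebesgue_stieltjes_measure F `<< lebesgue_measure.
Proof.
move=> Fac; apply/null_content_dominatesP => A mA A0.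
apply/eqP; rewrite eq_le measure_ge0 andbT; apply/lee_addgt0Pr => e e0.
rewrite add0e; have [d d0 Fd] := Fac e e0.
have [|U [oU AU Ud]] := lebesgue_regularity_outer mA _ d0; first by rewrite A0.
have mU : measurable (U : set (measurableTypeR R)) by exact: open_measurable.
have {}Ud : (lebesgue_measure U < d%:E)%E.
  rewrite (measureDI lebesgue_measure mU mA) setIC (setIidl AU).
  by rewrite [X in (_ + X)%E](_ : _ = 0%E) ?adde0.
have [J [Jo Jdis UJ]] := OpenSetDisjointItvs.open_disjoint_itv oU.
have mJ i : measurable (J i : set (measurableTypeR R)).
  by apply: open_measurable; case: (Jo i).
have JU i : J i `<=` U by rewrite UJ; exact: bigcup_sup.
(* Empty members of the sequence J receive the dummy endpoints (0, 0); the predicate P below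
   discards them. *)
have /choice[K HK] i : exists x : R * R, J i !=set0 ->
    x.1 < x.2 /\ J i = `]x.1, x.2[%classic.
  have [Ji0|] := pselect (J i !=set0); last by exists (0, 0).
  have [|u [v uv]] := open_interval_finite_measure (Jo i).2 (Jo i).1 Ji0.
    apply: le_lt_trans (lt_trans Ud (ltry _)).
    by apply: le_measure; rewrite ?inE.
  by exists (u, v).
have Js0 i : ~~ `[< J i !=set0 >] -> J i = set0.
  by move=> /asboolPn /set0P/negP; rewrite negbK => /eqP.
pose P i := `[< J i !=set0 >].
have partial_small n :
    (\sum_(0 <= i < n) lebesgue_stieltjes_measure F (J i) <= e%:E)%E.
  pose s := [seq K i | i <- index_iota 0 n & P i].
  have Hs : interval_family s.
    apply/andP; split.
      rewrite all_map all_filter; apply/allP => i _ /=; apply/implyP => /asboolP Ji0.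
      by apply: ltW; have [] := HK _ Ji0.
    rewrite pairwise_map; apply: (@sub_in_pairwise _ P (fun i j => i != j)).
    - move=> i j /asboolP Ji0 /asboolP Jj0 ij /=.
      have [iK Ji] := HK _ Ji0; have [jK Jj] := HK _ Jj0.
      apply/orP; rewrite !leNgt; apply/orP; rewrite -negb_and; apply/negP.
      move=> /andP[ji ij'].
      move/trivIsetP: Jdis => /(_ i j I I ij); rewrite Ji Jj.
      pose x := Order.max (K i).1 (K j).1; pose y := Order.min (K i).2 (K j).2.
      have xy : x < y by rewrite /x /y lt_min !gt_max iK jK ij' ji.
      (* Two overlapping members would share the midpoint of their overlap. *)
      move/eqP; apply/negP/set0P; exists ((x + y) / 2).
      have : x < (x + y) / 2 by lra.
      have : (x + y) / 2 < y by lra.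
      rewrite {2}/y {2}/x lt_min gt_max => /andP[? ?] /andP[? ?].
      by split; rewrite /= in_itv /=; apply/andP.
    - exact: filter_all.
    - by rewrite -uniq_pairwise filter_uniq // iota_uniq.
  have sd : \sum_(I <- s) (I.2 - I.1) < d.
    rewrite -lte_fin; apply: le_lt_trans Ud.
    apply: (@le_trans _ _ (lebesgue_measure (\big[setU/set0]_(i < n) J i))).
      rewrite measure_bigsetU // big_map big_filter -sumEFin.
      rewrite [X in (_ <= X)%E](bigID (fun i : 'I_n => P i)) /=.
      rewrite big_mkord [X in (_ <= _ + X)%E]big1 ?adde0; last first.
        by move=> i /Js0 ->; rewrite measure0.
      rewrite le_eqVlt; apply/orP; left; apply/eqP; apply: eq_bigr => i /asboolP Ji0.
      by have [iK ->] := HK _ Ji0; rewrite lebesgue_measure_itv /= lte_fin iK.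
    apply: le_measure; rewrite ?inE //; first exact: bigsetU_measurable.
    by rewrite -bigcup_mkord; apply: bigcup_sub => i _; exact: JU.
  rewrite big_mkord (bigID (fun i : 'I_n => P i)) /=.
  rewrite [X in (_ + X)%E]big1 ?adde0; last by move=> i /Js0 ->; rewrite measure0.
  have := ltW (Fd _ Hs sd); rewrite -lee_fin; apply: le_trans.
  rewrite big_map big_filter big_mkord -sumEFin; apply: lee_sum => i /asboolP Ji0.
  have [iK ->] := HK _ Ji0.
  (* The Stieltjes measure is known on half-open intervals, so the right endpoint is added. *)
  apply: (@le_trans _ _ (lebesgue_stieltjes_measure F `](K i).1, (K i).2])).
    by apply: le_measure; rewrite ?inE //; apply: subset_itvl; rewrite bnd_simp.
  by rewrite (lebesgue_stieltjes_itv _ (ltW iK)) lee_fin ler_norm.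
apply: (@le_trans _ _ (lebesgue_stieltjes_measure F U)).
  by apply: le_measure; rewrite ?inE.
rewrite UJ measure_bigcup //.
apply: lime_le; first by apply: is_cvg_nneseries.
apply: nearW => n; apply: le_trans (partial_small n).
by rewrite big_mkcond; apply: lee_sum => i _; case: ifP.
Qed.

(** The Stieltjes measure is restricted to []c, d]] to make it finite for Radon-Nikodym. As F is
    constant on either side of [[c, d]], nothing is lost, and the integral over []-oo, x]] still
    gives F x - F c. *)
Lemma nondecreasing_ac_density (R : realType) (F : R -> R) (c d : R) :
  c <= d -> {homo F : x y / x <= y} -> ac_function F ->
  (forall x, x <= c -> F x = F c) -> (forall x, d <= x -> F x = F d) ->
  exists h : R -> R,
    lebesgue_measure.-integrable [set: R] (EFin \o h) /\
    forall x, F x = F c + \int[lebesgue_measure]_(t in `]-oo, x]) h t.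
Proof.
move=> cd Fnd Fac Fc Fd.
have Frc := right_continuousW (ac_function_continuous Fac).
pose G : cumulative R R := HB.pack F (isCumulative.Build R _ R F Fnd Frc).
have mD : measurable (`]c, d] : set (measurableTypeR R)) by exact: measurable_itv.
have Dfin : (lebesgue_stieltjes_measure G `]c, d]%classic < +oo)%E.
  by rewrite lebesgue_stieltjes_itv // ltry.
pose nu : {finite_measure set _ -> \bar R} := mfrestr mD Dfin.
have numu : nu `<< lebesgue_measure.
  apply/null_content_dominatesP => A mA A0.
  have /null_content_dominatesP GA0 := lebesgue_stieltjes_dominates (F := G) Fac.
  rewrite /nu /= /mfrestr /mrestr; apply: GA0; first exact: measurableI.
  apply/eqP; rewrite eq_le measure_ge0 andbT -A0; apply: le_measure; rewrite ?inE //.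
  exact: measurableI.
have [g [g0 gfin gint gE]] := radon_nikodym_sigma_finite numu.
have hE : EFin \o (fine \o g) = g by apply/funext => x /=; rewrite fineK.
exists (fine \o g); split; first by rewrite hE.
move=> x; rewrite /Rintegral; under eq_integral do rewrite /= fineK //.
rewrite -gE; last exact: measurable_itv.
rewrite /nu /= /mfrestr /mrestr.
have [xc|cx] := leP x c.
  rewrite [X in lebesgue_stieltjes_measure _ X](_ : _ = set0).
    by rewrite measure0 addr0 Fc.
  rewrite -subset0 => y /= []; rewrite !in_itv /= => yx /andP[cy _].
  by have := le_lt_trans yx (le_lt_trans xc cy); rewrite ltxx.
rewrite [X in lebesgue_stieltjes_measure _ X](_ : _ = `]c, Order.min x d]%classic).
  rewrite lebesgue_stieltjes_itv /=; last by rewrite le_min ltW.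
  rewrite addrC subrK; case: leP => // /ltW dx.
  by rewrite Fd.
apply/seteqP; split => y /=; rewrite !in_itv /= le_min.
  by move=> [-> /andP[-> ->]].
by move=> /and3P[-> -> ->].
Qed.

Lemma ac_density (R : realType) (f : R -> R) (c d : R) :
  c <= d -> ac_function f ->
  (forall x, x <= c -> f x = f c) -> (forall x, d <= x -> f x = f d) ->
  exists h : R -> R,
    lebesgue_measure.-integrable [set: R] (EFin \o h) /\
    forall x, f x = f c + \int[lebesgue_measure]_(t in `]-oo, x]) h t.
Proof.
move=> cd fac fc fd.
pose V x := fine (total_variation c (Order.max c x) f).
have TVfin u v : u <= v -> total_variation u v f \is a fin_num.
  exact: ac_function_total_variation.
have cg x : c <= Order.max c x by rewrite le_max lexx.
have gnd : {homo Order.max c : x y / x <= y}.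
  by move=> x y xy; rewrite ge_max !le_max lexx xy orbT.
have fmax x : f (Order.max c x) = f x.
  by case: leP => // /ltW /fc ->.
have VB x y : x <= y ->
    V y - V x = fine (total_variation (Order.max c x) (Order.max c y) f).
  move=> xy; rewrite /V (total_variationD _ (cg x) (gnd _ _ xy)).
  by rewrite fineD ?TVfin ?gnd // addrC addKr.
have fV x y : x <= y -> `|f y - f x| <= V y - V x.
  move=> xy; rewrite VB // -(fmax y) -(fmax x) -lee_fin fineK ?TVfin ?gnd //.
  by apply: total_variation_ge; exact: gnd.
have Vac : ac_function V by exact: ac_function_total_variation_max.
have Vnd : {homo V : x y / x <= y}.
  by move=> x y xy; rewrite -subr_ge0 (le_trans _ (fV _ _ xy)).
have Wnd : {homo (fun x => V x - f x) : x y / x <= y}.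
  by move=> x y /fV /(le_trans (ler_norm _)); lra.
have Vc x : x <= c -> V x = V c by move=> xc; rewrite /V maxxx max_l.
have Vd x : d <= x -> V x = V d.
  move=> dx; apply/eqP; rewrite -subr_eq0 VB //; apply/eqP.
  rewrite !max_r //; last exact: le_trans dx.
  (* Beyond d the function f is constant, hence monotone, and its variation is its increment 0. *)
  rewrite nondecreasing_total_variation // => [|y z].
    by rewrite /= (fd x) // subrr.
  by rewrite !in_itv /= => /andP[dy _] /andP[dz _] _; rewrite (fd y) // (fd z).
have [h1 [ih1 Eh1]] := nondecreasing_ac_density cd Vnd Vac Vc Vd.
have Wc x : x <= c -> V x - f x = V c - f c by move=> xc; rewrite Vc ?fc.
have Wd x : d <= x -> V x - f x = V d - f d by move=> dx; rewrite Vd ?fd.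
have [h2 [ih2 Eh2]] := nondecreasing_ac_density cd Wnd (ac_functionB Vac fac) Wc Wd.
exists (fun x => h1 x - h2 x); split.
  rewrite (_ : _ \o _ = (EFin \o h1) \- (EFin \o h2))%E //.
  exact: integrableB.
move=> x; have := Eh2 x; rewrite {1}Eh1 RintegralB //.
- by move=> H; lra.
- by apply: (integrableS measurableT _ _ ih1).
- by apply: (integrableS measurableT _ _ ih2).
Qed.

Section nonmeasurable_integral.
Import HBNNSimple.

(* No measurability is assumed: elements of L_p are only almost everywhere equal
   to Borel functions. *)
Lemma ge0_ae_le_integral d (T : measurableType d) (R : realType)
    (mu : {measure set T -> \bar R}) (f g : T -> \bar R) :
  (forall x, 0 <= f x)%E -> (forall x, 0 <= g x)%E ->
  {ae mu, forall x, (f x <= g x)%E} ->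
  (\int[mu]_x f x <= \int[mu]_x g x)%E.
Proof.
move=> f0 g0 [N [mN N0 fgN]].
rewrite !ge0_integralTE //; apply: ge_ereal_sup => _ [h hf <-].
(* Setting h to 0 on the exceptional null set N keeps its integral and puts it below g everywhere,
   so that it competes in the supremum defining the integral of g. *)
pose h' := proj_nnsfun h (measurableC mN).
have h'E x : h' x = if x \in N then 0 else h x.
  rewrite /h' /= mindicE in_setC.
  by case: (x \in N); rewrite /= ?mulr0 ?mulr1.
have -> : sintegral mu h = sintegral mu h'.
  rewrite -!integralT_nnsfun; apply: ae_eq_integral => //.
  - exact/measurable_EFinP.
  - exact/measurable_EFinP.
  exists N; split=> // x /= hx; apply: contrapT => xN; apply: hx => _.
  by congr (_%:E); move: (h'E x); rewrite memNset.
apply: ereal_sup_ubound; exists h' => // x.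
rewrite h'E; case: ifPn => [_|]; first exact: g0.
rewrite notin_setE => xN; apply: le_trans (hf x) _.
by apply: contrapT => /fgN.
Qed.

End nonmeasurable_integral.

Instance lebesgue_ae_filter (R : realType) :
  Filter (almost_everywhere (@lebesgue_measure R)).
Proof. exact: (ae_filter_ringOfSetsType (@lebesgue_measure R)). Qed.

(** Clamping makes g constant outside [[c, d]], as [ac_density] demands. Around an interior point
    the clamped function is g itself, so the derivative given by Lebesgue's theorem is that of g. *)
Lemma ac_density_derive (R : realType) (g : R -> R) (c d : R) : c <= d ->
  ac_function (fun x => g (Order.max c (Order.min d x))) ->
  exists h : R -> R, [/\
    lebesgue_measure.-integrable [set: R] (EFin \o h),
    {ae lebesgue_measure, forall x, x \in `]c, d[ -> is_derive x 1 g (h x)} &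
    forall x y, c <= x -> x <= y -> y <= d ->
      g y - g x = \int[lebesgue_measure]_(t in `]x, y]) h t].
Proof.
move=> cd gac; set f := fun x => _ in gac.
have fE x : c <= x <= d -> f x = g x.
  by move=> /andP[cx xd]; rewrite /f (min_r xd) (max_r cx).
have fc x : x <= c -> f x = f c.
  by move=> xc; rewrite /f (min_r cd) maxxx max_l // ge_min xc orbT.
have fd x : d <= x -> f x = f d.
  by move=> dx; rewrite /f (min_l dx) minxx.
have [h [ih Eh]] := ac_density cd gac fc fd.
exists h; split=> //.
- have ihy y : lebesgue_measure.-integrable `]-oo, y] (EFin \o h).
    by apply: (integrableS measurableT _ _ ih).
  have lh : locally_integrable [set: R] h.
    by have := integrable_locally measurableT ih; rewrite patch_setT.
  have := FTC1Ny ihy lh; apply: filterS => x /= [dF Fh] xcd.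
  have F1 : is_derive x 1
      (fun x => f c + \int[lebesgue_measure]_(t in `]-oo, x]) h t) (h x).
    rewrite -[h x]add0r; apply: is_deriveD.
    by apply: DeriveDef; [exact: dF|rewrite -derive1E].
  apply: near_eq_is_derive F1.
  have := near_in_itvoo xcd; apply: filterS => y; rewrite in_itv /= => /andP[cy yd].
  by rewrite -Eh fE // !ltW.
- move=> x y cx xy yd.
  have -> : g y = f y by rewrite fE // yd (le_trans cx).
  have -> : g x = f x by rewrite fE // cx (le_trans xy).
  rewrite (Eh y) (Eh x) opprD addrACA subrr add0r.
  rewrite (@Rintegral_itvB _ h (BInfty _ true)) //.
  by apply: (integrableS measurableT _ _ ih).
Qed.

(** * The L_p norm of Lebesgue measurable functions *)

Lemma ae_le_Lnorm d (T : measurableType d) (R : realType)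
    (mu : {measure set T -> \bar R}) (p : \bar R) (u v : T -> \bar R) :
  (1 <= p)%E -> {ae mu, forall x, (`|u x| <= `|v x|)%E} ->
  ('N[mu]_p[u] <= 'N[mu]_p[v])%E.
Proof.
move=> p1 uv; rewrite unlock /Lnorm; case: p p1 => [r r1||//].
  rewrite lee_fin in r1.
  have r0 : 0 < r by exact: lt_le_trans r1.
  apply: gt0_ler_poweR.
  - by rewrite invr_ge0 ltW.
  - by rewrite in_itv /= leey andbT; apply: integral_ge0 => x _; exact: poweR_ge0.
  - by rewrite in_itv /= leey andbT; apply: integral_ge0 => x _; exact: poweR_ge0.
  apply: ge0_ae_le_integral => [x|x|]; rewrite ?poweR_ge0 //.
  apply: filterS uv => x uvx; apply: gt0_ler_poweR => //; first exact: ltW.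
  - by rewrite in_itv /= leey andbT abse_ge0.
  - by rewrite in_itv /= leey andbT abse_ge0.
by move=> _; case: ifP => // _; exact: le_ess_sup.
Qed.

Lemma ge0_LnormZ d (T : measurableType d) (R : realType)
    (mu : {measure set T -> \bar R}) (p : \bar R) (K : R) (w : T -> R) :
  (1 <= p)%E -> 0 <= K -> measurable_fun [set: T] w ->
  ('N[mu]_p[(fun x => (K * w x)%:E)] = K%:E * 'N[mu]_p[EFin \o w])%E.
Proof.
move=> p1 K0 mw; rewrite unlock /Lnorm; case: p p1 => [r r1||//].
  rewrite lee_fin in r1.
  have r0 : 0 < r by exact: lt_le_trans r1.
  under eq_integral => x _ do
    rewrite EFinM abseM gee0_abs ?lee_fin // poweRM ?lee_fin ?abse_ge0 //.
  rewrite /= ge0_integralZl //; last 2 first.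
  - apply/measurable_EFinP.
    apply: (measurableT_comp (measurable_powR r)).
    exact: measurableT_comp.
  - by rewrite lee_fin powR_ge0.
  rewrite poweRM ?poweR_ge0 //; last first.
    by apply: integral_ge0 => x _; rewrite lee_fin powR_ge0.
    by rewrite lee_fin powR_ge0.
  by rewrite poweR_EFin -powRrM mulfV ?gt_eqF // powRr1.
move=> _; case: ifPn => [mu0|]; last by rewrite mule0.
rewrite -ess_supZl //; congr ess_sup; apply/funext => x /=.
by rewrite /= normrM ger0_norm.
Qed.

Section modulus.
Variable R : realType.
Implicit Types (a b : R) (f g : R -> R[i]) (z : R[i]).

Lemma normc_ge0 z : 0 <= Normc.normc z.
Proof. by case: z => x y; exact: sqrtr_ge0. Qed.

Lemma Re_le_normc z : `|complex.Re z| <= Normc.normc z.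
Proof.
case: z => x y /=; rewrite -sqrtr_sqr ler_wsqrtr // lerDl.
exact: sqr_ge0.
Qed.

Lemma Im_le_normc z : `|complex.Im z| <= Normc.normc z.
Proof.
case: z => x y /=; rewrite -sqrtr_sqr ler_wsqrtr // lerDr.
exact: sqr_ge0.
Qed.

Lemma normc_le_ReIm z : Normc.normc z <= `|complex.Re z| + `|complex.Im z|.
Proof.
case: z => x y /=; rewrite -[leRHS]ger0_norm ?addr_ge0 // -sqrtr_sqr.
rewrite ler_wsqrtr // sqrrD !real_normK ?num_real // -addrA.
rewrite [X in _ <= _ + X]addrC lerD2l lerDl.
by rewrite mulrn_wge0 // mulr_ge0.
Qed.

(** The Borel function w replaces the modulus of f wherever a result, such as Minkowski's
    inequality, requires measurability. *)
Lemma Lebesgue_measurable_modulus a b f : Lebesgue_measurable a b f ->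
  exists w : R -> R, [/\ measurable_fun [set: R] w, forall x, 0 <= w x &
    {ae lebesgue_measure, forall x,
      ((fun x => (Normc.normc (f x))%:E) \_ `]a, b[)%E x = (w x)%:E}].
Proof.
move=> [g [mre mim fg]].
pose w := (fun x => Normc.normc (g x)) \_ (`]a, b[ : set R).
exists w; split.
- apply/(measurable_restrictT _ (measurable_itv _)) => /=.
  have -> : (fun x => Normc.normc (g x)) =
      @Num.sqrt R \o (fun x => reC g x ^+ 2 + imC g x ^+ 2).
    by apply/funext => x; rewrite /reC /imC /=; case: (g x).
  apply: measurableT_comp.
    apply: continuous_measurable_fun. exact: sqrt_continuous.
  by apply: measurable_funD; apply: measurable_funX.
- by move=> x; rewrite /w patchE; case: ifP => // _; exact: normc_ge0.
- apply: filterS fg => x fgx; rewrite /w !patchE.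
  by case: ifPn => // /set_mem /= /fgx ->.
Qed.

Lemma Lpnorm_eq_modulus a b p f (w : R -> R) : (1 <= p)%E ->
  {ae lebesgue_measure, forall x,
      ((fun x => (Normc.normc (f x))%:E) \_ `]a, b[)%E x = (w x)%:E} ->
  Lpnorm a b p f = 'N[lebesgue_measure]_p[EFin \o w]%E.
Proof.
move=> p1 fw; apply/eqP; rewrite eq_le; apply/andP; split;
  apply: ae_le_Lnorm => //; apply: filterS fw => x /= -> //.
Qed.

Lemma Lpnorm_ge0 a b p f : (0 <= Lpnorm a b p f)%E.
Proof. exact: Lnorm_ge0. Qed.

Lemma Lpnorm_ae_le a b p (K : R) f g : (1 <= p)%E -> 0 <= K ->
  Lebesgue_measurable a b g ->
  {ae lebesgue_measure, forall x, x \in `]a, b[ ->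
      Normc.normc (f x) <= K * Normc.normc (g x)} ->
  (Lpnorm a b p f <= K%:E * Lpnorm a b p g)%E.
Proof.
move=> p1 K0 /Lebesgue_measurable_modulus[w [mw w0 gw]] fg.
rewrite (Lpnorm_eq_modulus p1 gw) -ge0_LnormZ //.
apply: ae_le_Lnorm => //; apply: filterS2 gw fg => x; rewrite !patchE.
case: ifPn => [/set_mem /= xab [gwx] /(_ xab) fgx|_ [wx] _].
  rewrite lee_fin !ger0_norm ?normc_ge0 ?mulr_ge0 //.
  by rewrite -gwx.
by rewrite -wx mulr0.
Qed.

Lemma Lpnorm_ae_eq a b p f g : (1 <= p)%E ->
  {ae lebesgue_measure, forall x, x \in `]a, b[ -> f x = g x} ->
  Lpnorm a b p f = Lpnorm a b p g.
Proof.
move=> p1 fg; apply/eqP; rewrite eq_le; apply/andP; split;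
  apply: ae_le_Lnorm => //; apply: filterS fg => x fgx; rewrite !patchE;
  by case: ifPn => // /set_mem /= /fgx ->.
Qed.

Lemma Lebesgue_measurable_ae_eq a b f g : Lebesgue_measurable a b f ->
  {ae lebesgue_measure, forall x, x \in `]a, b[ -> f x = g x} ->
  Lebesgue_measurable a b g.
Proof.
move=> [h [mre mim fh]] fg; exists h; split=> //.
by apply: filterS2 fg fh => x fgx fhx xab; rewrite -fgx // fhx.
Qed.

Lemma Lebesgue_measurableD a b f g :
  Lebesgue_measurable a b f -> Lebesgue_measurable a b g ->
  Lebesgue_measurable a b (fun x => f x + g x).
Proof.
move=> [f' [mf1 mf2 ff']] [g' [mg1 mg2 gg']].
exists (fun x => f' x + g' x); split.
- rewrite (_ : reC _ = reC f' \+ reC g'); first exact: measurable_funD.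
  by apply/funext => x; rewrite /reC /=; case: (f' x); case: (g' x).
- rewrite (_ : imC _ = imC f' \+ imC g'); first exact: measurable_funD.
  by apply/funext => x; rewrite /imC /=; case: (f' x); case: (g' x).
- by apply: filterS2 ff' gg' => x fx gx xab; rewrite fx // gx.
Qed.

Lemma Lebesgue_measurableM a b f g :
  Lebesgue_measurable a b f -> Lebesgue_measurable a b g ->
  Lebesgue_measurable a b (fun x => f x * g x).
Proof.
move=> [f' [mf1 mf2 ff']] [g' [mg1 mg2 gg']].
exists (fun x => f' x * g' x); split.
- rewrite (_ : reC _ = (reC f' \* reC g') \- (imC f' \* imC g')).
    by apply: measurable_funB; apply: measurable_funM.
  by apply/funext => x; rewrite /reC /imC /=; case: (f' x); case: (g' x).
- rewrite (_ : imC _ = (reC f' \* imC g') \+ (imC f' \* reC g')).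
    by apply: measurable_funD; apply: measurable_funM.
  by apply/funext => x; rewrite /reC /imC /=; case: (f' x); case: (g' x).
- by apply: filterS2 ff' gg' => x fx gx xab; rewrite fx // gx.
Qed.

Lemma Lebesgue_measurable_cst a b z : Lebesgue_measurable a b (fun=> z).
Proof.
exists (fun=> z); split; rewrite /reC /imC; try exact: measurable_cst.
exact/nearW.
Qed.

Lemma le_LpnormD a b p f g : (1 <= p)%E ->
  Lebesgue_measurable a b f -> Lebesgue_measurable a b g ->
  (Lpnorm a b p (fun x => f x + g x)%R <= Lpnorm a b p f + Lpnorm a b p g)%E.
Proof.
move=> p1 /Lebesgue_measurable_modulus[w [mw w0 fw]].
move=> /Lebesgue_measurable_modulus[v [mv v0 gv]].
rewrite (Lpnorm_eq_modulus p1 fw) (Lpnorm_eq_modulus p1 gv).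
have mink := eminkowski lebesgue_measure mw mv p1; apply: le_trans mink.
apply: ae_le_Lnorm => //; apply: filterS2 fw gv => x /=; rewrite !patchE.
case: ifPn => _ [<-] [<-]; last by rewrite /= addr0.
rewrite /= lee_fin !ger0_norm ?addr_ge0 ?normc_ge0 //.
exact: le_normcD.
Qed.

Lemma Lebesgue_measurable_sum a b (I : Type) (r : seq I) (F : I -> R -> R[i]) :
  (forall i, Lebesgue_measurable a b (F i)) ->
  Lebesgue_measurable a b (fun x => \sum_(i <- r) F i x).
Proof.
move=> mF; elim: r => [|i r IH].
  under eq_fun do rewrite big_nil; exact: Lebesgue_measurable_cst.
under eq_fun do rewrite big_cons; exact: Lebesgue_measurableD.
Qed.

Lemma le_Lpnorm_sum a b p (I : Type) (r : seq I) (F : I -> R -> R[i]) :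
  (1 <= p)%E -> (forall i, Lebesgue_measurable a b (F i)) ->
  (Lpnorm a b p (fun x => \sum_(i <- r) F i x)%R
     <= \sum_(i <- r) Lpnorm a b p (F i))%E.
Proof.
move=> p1 mF; elim: r => [|i r IH].
  rewrite big_nil; under eq_fun do rewrite big_nil.
  have := @Lpnorm_ae_le a b p 0 (fun=> 0) (fun=> 0) p1 (lexx _)
    (Lebesgue_measurable_cst a b 0).
  by rewrite mul0e; apply; apply/nearW => x _; rewrite Normc.normc0 mul0r.
under eq_fun do rewrite big_cons; rewrite big_cons.
apply: le_trans (le_LpnormD p1 (mF i) (Lebesgue_measurable_sum r mF)) _.
by rewrite leeD2l.
Qed.

End modulus.

(** Each segment [[a + e n, b - e n]] contributes a null set of exceptional points, and countably
    many of them exhaust []a, b[]. *)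
Lemma ac_itv_derivable (R : realType) (a b : R) (g : R -> R) :
  (forall c d, a < c -> c <= d -> d < b ->
    ac_function (fun x => g (Order.max c (Order.min d x)))) ->
  {ae lebesgue_measure, forall x, x \in `]a, b[ -> derivable g x 1}.
Proof.
move=> gac.
(* The shift by 3 gives [3 * e n <= b - a], so that every segment is nondegenerate. *)
pose e n : R := (b - a) / n.+3%:R.
have H n : {ae lebesgue_measure, forall x, a < b -> x \in `](a + e n), (b - e n)[ ->
    derivable g x 1}.
  have [ba|ab] := leP b a; first by apply: nearW.
  have en0 : 0 < e n by rewrite divr_gt0 ?subr_gt0.
  have en : e n * 3 <= b - a.
    rewrite /e -mulrA ger_pMr ?subr_gt0 // mulrC ler_pdivrMr ?ltr0n // mul1r.
    by rewrite ler_nat.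
  have ce : a + e n <= b - e n by lra.
  have gacn := gac (a + e n) (b - e n).
  have [||h [_ hae _]] := ac_density_derive ce (gacn _ ce _); [lra|lra|].
  by apply: filterS hae => x hx _ /hx [].
move/ae_foralln: H; apply: filterS => x Hx xab.
have [ax xb] : a < x /\ x < b by move: xab; rewrite in_itv /= => /andP.
have ab : a < b by exact: lt_trans xb.
pose t := Order.min (x - a) (b - x).
have t0 : 0 < t by rewrite lt_min !subr_gt0 ax.
have [n en] : exists n, e n < t.
  exists (Num.bound ((b - a) / t)); rewrite /e ltr_pdivrMr ?ltr0n //.
  rewrite mulrC -ltr_pdivrMr //.
  have : 0 <= (b - a) / t by apply: divr_ge0; [rewrite subr_ge0|]; exact: ltW.
  by move=> /archi_boundP /lt_le_trans; apply; rewrite ler_nat -addn3 leq_addr.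
apply: (Hx n ab); move: en; rewrite lt_min in_itv /= => /andP[]; lra.
Qed.

Lemma ac_itv_increment (R : realType) (a b : R) (g : R -> R) :
  (forall c d, a < c -> c <= d -> d < b ->
    ac_function (fun x => g (Order.max c (Order.min d x)))) ->
  forall x y, x \in `]a, b[ -> y \in `]a, b[ ->
  (`|g y - g x|%:E <= \int[lebesgue_measure]_(t in `]a, b[) `|derive1 g t|%:E)%E.
Proof.
move=> gac x y; wlog xy : x y / x <= y.
  move=> W xab yab; have [xy|/ltW yx] := leP x y; first exact: W.
  by rewrite distrC; apply: W.
rewrite !in_itv /= => /andP[ax _] /andP[_ yb].
have [h [ih hae hE]] := ac_density_derive xy (gac _ _ ax xy yb).
rewrite (hE x y) //.
have ihxy : lebesgue_measure.-integrable `]x, y] (EFin \o h).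
  by apply: (integrableS measurableT _ _ ih).
have mabs : measurable_fun [set: R] (EFin \o h) by case/integrableP: ih.
apply: (@le_trans _ _ (\int[lebesgue_measure]_(t in `]x, y]) `|h t|%:E)%E).
  have := le_abse_integral lebesgue_measure (measurable_itv `]x, y])
    (measurable_int _ ihxy).
  rewrite /Rintegral -abse_EFin fineK //; last exact: integrable_fin_num.
rewrite integral_mkcond [leRHS]integral_mkcond.
apply: ge0_ae_le_integral => [t|t|].
- by rewrite patchE; case: ifP.
- by rewrite patchE; case: ifP.
(* The integral runs over []x, y]], whereas h is known to be the derivative only on []x, y[]. *)
have y0 : {ae lebesgue_measure, forall t : R, t != y}.
  exists [set y]; split => //; first exact: lebesgue_measure_set1.
  by move=> t /= /negP; rewrite negbK => /eqP.
apply: filterS2 y0 hae => t ty ht; rewrite !patchE.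
case: ifPn => [/set_mem /=|_]; last by case: ifP; rewrite // lee_fin.
rewrite in_itv /= => /andP[xt]; rewrite le_eqVlt (negbTE ty) /= => tyy.
rewrite mem_set /=; last by rewrite in_itv /= (lt_trans ax xt) (lt_trans tyy yb).
have /ht ht' : t \in `]x, y[ by rewrite in_itv /= xt.
by rewrite derive1E; case: ht' => _ ->.
Qed.

(** * Absolute continuity on the open interval, and the inclusion of L_p in L_1 *)

Section abs_continuous_functions.
Variables (R : realType) (a b : R).
Implicit Types (f : R -> R[i]) (p : \bar R).

(** Clamping to [[c, d]] moves every endpoint strictly inside []a, b[], where [abs_continuous]
    speaks. It is monotone and non-expansive, so families stay disjoint and do not get longer. The
    1-Lipschitz phi will be the real or the imaginary part. *)
Lemma abs_continuous_ac_function (phi : R[i] -> R) f (c d : R) :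
  (forall z w, `|phi z - phi w| <= Normc.normc (z - w)) ->
  abs_continuous a b f -> a < c -> c <= d -> d < b ->
  ac_function (fun x => phi (f (Order.max c (Order.min d x)))).
Proof.
move=> phi1 fac ac cd db e e0; have [eta eta0 feta] := fac e e0.
pose g x := Order.max c (Order.min d x).
have gnd : {homo g : x y / x <= y}.
  move=> x y xy; rewrite /g ge_max le_max lexx /= le_max; apply/orP; right.
  by rewrite le_min ge_min lexx /= ge_min xy orbT.
have gitv x : a < g x < b.
  by rewrite /g lt_max ac /= gt_max gt_min db (le_lt_trans cd db).
exists eta => // s Hs sd.
pose u (i : 'I_(size s)) := g (nth (0, 0) s i).1.
pose v (i : 'I_(size s)) := g (nth (0, 0) s i).2.
have [Hle Hpw] := andP Hs.
have ule (i : 'I_(size s)) : (nth (0, 0) s i).1 <= (nth (0, 0) s i).2.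
  by apply: (allP Hle); exact: mem_nth.
have dis : trivIset [set: 'I_(size s)] (fun i => [set` `]u i, v i[]).
  apply/trivIsetP => i j _ _; rewrite -val_eqE /=.
  wlog ij : i j / (i < j)%N.
    move=> W; rewrite neq_ltn => /orP[ij|ij]; first by apply: W => //; rewrite ltn_eqF.
    by rewrite setIC; apply: W => //; rewrite ltn_eqF.
  move=> _; move/(pairwiseP (0, 0)): (Hpw) => /(_ i j).
  rewrite !inE !ltn_ord => /(_ isT isT ij).
  move=> /orP[|] /gnd h; rewrite -subset0 => x /= [];
    rewrite !in_itv /= => /andP[h1 h2] /andP[h3 h4].
    by have := lt_trans h3 (lt_le_trans h2 h); rewrite ltxx.
  by have := lt_trans h1 (lt_le_trans h4 h); rewrite ltxx.
rewrite (big_nth (0, 0)) big_mkord.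
apply: le_lt_trans (feta _ u v _ dis _).
- by apply: ler_sum => i _; exact: phi1.
- move=> i; have /andP[au _] := gitv (nth (0, 0) s i).1.
  by have /andP[_ vb] := gitv (nth (0, 0) s i).2; split=> //; exact: gnd.
apply: le_lt_trans sd; rewrite (big_nth (0, 0)) big_mkord.
apply: ler_sum => i _; have := ule i; rewrite /u /v /g.
move: (nth _ _ _) => [x y] /= xy.
by case: (leP d x) => h1; case: (leP d y) => h2;
  rewrite ?(max_r cd); case: (leP c x) => h3; case: (leP c y) => h4; lra.
Qed.

Lemma lipschitz_abs_continuous f (K : R) :
  (forall x y, x \in `]a, b[ -> y \in `]a, b[ -> x <= y ->
     Normc.normc (f y - f x) <= K * (y - x)) ->
  abs_continuous a b f.
Proof.
move=> fK e e0; pose L := Order.max K 1.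
have L0 : 0 < L by rewrite lt_max ltr01 orbT.
exists (e / L); first by rewrite divr_gt0.
move=> N u v uv _; rewrite ltr_pdivlMr // mulrC mulr_sumr; apply: le_lt_trans.
apply: ler_sum => i _; have [au uvi vb] := uv i.
apply: le_trans (fK _ _ _ _ uvi) _.
- by rewrite in_itv /= au (le_lt_trans uvi).
- by rewrite in_itv /= vb (lt_le_trans au).
by apply: ler_wpM2r; rewrite ?subr_ge0 // le_max lexx.
Qed.

Lemma lebesgue_measure_bounded_itv :
  exists2 l : R, 0 <= l & lebesgue_measure `]a, b[%classic = l%:E.
Proof.
rewrite lebesgue_measure_itv /= lte_fin; case: ltP => [ab|_]; last by exists 0.
by exists (b - a); rewrite ?EFinB // subr_ge0 ltW.
Qed.

Lemma Lpnorm_cst_fin p (z : R[i]) : (1 <= p)%E -> (Lpnorm a b p (fun=> z) < +oo)%E.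
Proof.
move=> p1; rewrite /Lpnorm unlock; case: p p1 => [r r1||//].
  rewrite lee_fin in r1; have r0 : 0 < r by exact: lt_le_trans r1.
  apply: poweR_lty.
  apply: (@le_lt_trans _ _
    (\int[lebesgue_measure]_(x in `]a, b[) (Normc.normc z `^ r)%:E)%E).
    rewrite [leRHS]integral_mkcond; apply: ge0_ae_le_integral.
    - by move=> x; exact: poweR_ge0.
    - by move=> x; rewrite patchE; case: ifP; rewrite // lee_fin powR_ge0.
    apply: nearW => x; rewrite !patchE; case: ifP => _ /=.
      by rewrite ger0_norm ?normc_ge0.
    by rewrite normr0 powR0 // gt_eqF.
  rewrite integral_cst //.
  rewrite lte_mul_pinfty ?lee_fin ?powR_ge0 //.
  by have [l _ lE] := lebesgue_measure_bounded_itv; have := ltry l; rewrite -lE; apply.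
move=> _; case: ifP => // _.
apply: (@le_lt_trans _ _ (Normc.normc z)%:E); last exact: ltry.
apply/ess_supP; apply: nearW => x; rewrite /= patchE; case: ifP => _ /=.
  by rewrite lee_fin ger0_norm ?normc_ge0.
by rewrite lee_fin normr0 normc_ge0.
Qed.

Lemma Lpnorm_bounded p f (K : R) : (1 <= p)%E ->
  (forall x, x \in `]a, b[ -> Normc.normc (f x) <= K) -> (Lpnorm a b p f < +oo)%E.
Proof.
move=> p1 fK; pose L := Order.max K 0.
apply: (@le_lt_trans _ _ (L%:E * Lpnorm a b p (fun=> 1%R))%E).
  apply: Lpnorm_ae_le => //; first by rewrite le_max lexx orbT.
    exact: Lebesgue_measurable_cst.
  by apply: nearW => x xab; rewrite Normc.normc1 mulr1 le_max fK.
by rewrite lte_mul_pinfty ?Lpnorm_cst_fin // lee_fin le_max lexx orbT.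
Qed.

(** For finite r >= 1, [t <= 1 + t ^ r] for every t >= 0; integrated over the interval of length l,
    this gives [l + M ^ r]. For p = +oo the bound is [M * l]. *)
Lemma Lpnorm_integral_bound p (N : R) : (1 <= p)%E -> exists C : R,
  0 <= C /\
  forall f, Lebesgue_measurable a b f -> (Lpnorm a b p f <= N%:E)%E ->
    (\int[lebesgue_measure]_(x in `]a, b[) (Normc.normc (f x))%:E <= C%:E)%E.
Proof.
move=> p1.
have [l l0 lE] := lebesgue_measure_bounded_itv.
pose M := Order.max N 0; have M0 : 0 <= M by rewrite le_max lexx orbT.
case: p p1 => [r r1||//].
- rewrite lee_fin in r1; have r0 : 0 < r by exact: lt_le_trans r1.
  exists (l + M `^ r); split; first by rewrite addr_ge0 ?powR_ge0.
  move=> f /Lebesgue_measurable_modulus[w [mw w0 fw]].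
  rewrite (@Lpnorm_eq_modulus _ _ _ _ _ w) ?lee_fin // => wN.
  have {}wN : (\int[lebesgue_measure]_x ((w x) `^ r)%:E <= (M `^ r)%:E)%E.
    have := @poweR_Lnorm _ _ _ lebesgue_measure (EFin \o w) r.
    rewrite gt_eqF // => /(_ isT).
    under eq_integral do rewrite /= ger0_norm //.
    move=> <-; rewrite -poweR_EFin; apply: gt0_ler_poweR; first exact: ltW.
    - by rewrite in_itv /= leey andbT Lnorm_ge0.
    - by rewrite in_itv /= leey andbT lee_fin.
    - by apply: le_trans wN _; rewrite lee_fin le_max lexx.
  have lI : (l%:E = \int[lebesgue_measure]_x (\1_(`]a, b[ : set R) x)%:E)%E.
    by rewrite integral_indic // setIT.
  rewrite EFinD lI; apply: le_trans (leeD2l _ wN).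
  rewrite -ge0_integralD //; last 3 first.
  - by apply/measurable_EFinP; apply: measurable_indic.
  - by move=> x _; rewrite lee_fin powR_ge0.
  - apply/measurable_EFinP; exact: (measurableT_comp (measurable_powR r)).
  rewrite [leLHS]integral_mkcond.
  apply: (@ge0_ae_le_integral _ _ R lebesgue_measure).
  - by move=> x; rewrite patchE; case: ifP; rewrite // lee_fin normc_ge0.
  - by move=> x; rewrite -EFinD lee_fin addr_ge0 ?powR_ge0.
  apply: filterS fw => x; rewrite !patchE indicE; case: ifPn => [_|_ _].
    move=> [->]; rewrite -EFinD lee_fin.
    have [w1|/ltW w1] := leP (w x) 1; first by rewrite (le_trans w1) // lerDl powR_ge0.
    by rewrite (le_trans (le1r_powR w1 r1)) // lerDr.
  by rewrite -EFinD lee_fin addr_ge0 ?powR_ge0.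
- move=> _; exists (M * l); split; first exact: mulr_ge0.
  move=> f _; rewrite /Lpnorm unlock /Lnorm.
  (* The L_oo norm is an essential supremum only when the space has positive measure, and 0
     otherwise. *)
  have -> : (0 < lebesgue_measure [set: R])%E.
    by rewrite -set_itvNyy lebesgue_measure_itv /= addye // ltry.
  move=> /ess_supP fN; rewrite EFinM -lE -integral_cst //.
  rewrite [leLHS]integral_mkcond [leRHS]integral_mkcond.
  apply: (@ge0_ae_le_integral _ _ R lebesgue_measure).
  - by move=> x; rewrite patchE; case: ifP; rewrite // lee_fin normc_ge0.
  - by move=> x; rewrite patchE; case: ifP; rewrite // lee_fin.
  apply: filterS fN => x /=; rewrite !patchE; case: ifPn => // _ /=.
  by rewrite ger0_norm ?normc_ge0 // !lee_fin => /le_trans; apply; rewrite le_max lexx.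
Qed.

End abs_continuous_functions.

(** * Regularity of Sobolev functions *)

Section Sobolev_functions.
Variables (R : realType) (a b : R).
Implicit Types (f : R -> R[i]) (p : \bar R) (k s : nat).

Lemma Re_lipschitz (z w : R[i]) :
  `|complex.Re z - complex.Re w| <= Normc.normc (z - w).
Proof. by apply: le_trans (Re_le_normc (z - w)); case: z; case: w. Qed.

Lemma Im_lipschitz (z w : R[i]) :
  `|complex.Im z - complex.Im w| <= Normc.normc (z - w).
Proof. by apply: le_trans (Im_le_normc (z - w)); case: z; case: w. Qed.

Lemma abs_continuous_cderivable f : abs_continuous a b f ->
  {ae lebesgue_measure, forall x, x \in `]a, b[ -> cderivable f x}.
Proof.
move=> fac.
have dre := @ac_itv_derivable _ a b (reC f)
  (fun c d => @abs_continuous_ac_function _ a b _ f c d Re_lipschitz fac).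
have dim := @ac_itv_derivable _ a b (imC f)
  (fun c d => @abs_continuous_ac_function _ a b _ f c d Im_lipschitz fac).
apply: filterS2 dre dim => x hre him xab.
by split; [exact: hre|exact: him].
Qed.

(** One integral bounds the increment of the real part, the other that of the imaginary part. *)
Lemma abs_continuous_increment f x y : abs_continuous a b f ->
  x \in `]a, b[ -> y \in `]a, b[ ->
  ((Normc.normc (f y - f x)%R)%:E <=
   \int[lebesgue_measure]_(t in `]a, b[) (Normc.normc (cderivn 1 f t))%:E +
   \int[lebesgue_measure]_(t in `]a, b[) (Normc.normc (cderivn 1 f t))%:E)%E.
Proof.
move=> fac xab yab.
have dre := @ac_itv_increment _ a b (reC f)
  (fun c d => @abs_continuous_ac_function _ a b _ f c d Re_lipschitz fac) _ _ xab yab.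
have dim := @ac_itv_increment _ a b (imC f)
  (fun c d => @abs_continuous_ac_function _ a b _ f c d Im_lipschitz fac) _ _ xab yab.
have mono (h : R -> R) : (forall t, `|h t| <= Normc.normc (cderivn 1 f t)) ->
    (\int[lebesgue_measure]_(t in `]a, b[) `|h t|%:E <=
     \int[lebesgue_measure]_(t in `]a, b[) (Normc.normc (cderivn 1 f t))%:E)%E.
  move=> hf; rewrite integral_mkcond [leRHS]integral_mkcond.
  apply: (@ge0_ae_le_integral _ _ R lebesgue_measure).
  - by move=> t; rewrite patchE; case: ifP; rewrite // lee_fin.
  - by move=> t; rewrite patchE; case: ifP; rewrite // lee_fin normc_ge0.
  by apply: nearW => t; rewrite !patchE; case: ifP; rewrite // lee_fin.
apply: le_trans (leeD (le_trans dre (mono _ _)) (le_trans dim (mono _ _))).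
- rewrite -EFinD lee_fin; apply: le_trans (normc_le_ReIm _) _.
  by rewrite /reC /imC; case: (f y); case: (f x).
- by move=> t; apply: le_trans (Re_le_normc _).
- by move=> t; apply: le_trans (Im_le_normc _).
Qed.

Lemma abs_continuous_measurable f :
  abs_continuous a b f -> Lebesgue_measurable a b f.
Proof.
move=> fac.
have cont (phi : R[i] -> R) :
    (forall z w, `|phi z - phi w| <= Normc.normc (z - w)) ->
    measurable_fun `]a, b[ (phi \o f).
  move=> phi1; apply: subspace_continuous_measurable_fun => //.
  apply: continuous_in_subspaceT => x /set_mem /= xab.
  apply/cvgrPdist_lt => e e0; have [d d0 fd] := fac e e0.
  have small u v : a < u -> u <= v -> v < b -> v - u < d ->
      Normc.normc (f v - f u) < e.
    move=> au uv vb vud; have := fd 1%N (fun=> u) (fun=> v).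
    rewrite !big_ord1; apply=> //.
    by apply/trivIsetP => i j _ _; rewrite (ord1 i) (ord1 j) eqxx.
  have [ax xb] : a < x /\ x < b by move: xab; rewrite in_itv /= => /andP.
  near=> y.
  have /andP[ay yb] : a < y < b.
    by near: y; have := near_in_itvoo xab; apply: filterS => y; rewrite in_itv.
  have xy : `|x - y| < d by near: y; apply: (@cvgr_dist_lt _ R^o).
  have [h|/ltW h] := leP y x.
    rewrite (le_lt_trans (phi1 _ _)) // small //.
    by rewrite ger0_norm ?subr_ge0 in xy.
  rewrite distrC (le_lt_trans (phi1 _ _)) // small //.
  by rewrite distrC ger0_norm ?subr_ge0 in xy.
exists f; split; first exact: (cont _ Re_lipschitz).
  exact: (cont _ Im_lipschitz).
exact: nearW.
Unshelve. all: by end_near. Qed.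

(** The mean value theorem, applied to the real and imaginary parts separately, yields the Lipschitz
    constant K + K. *)
Lemma bounded_cderiv_abs_continuous f (K : R) :
  (forall x, x \in `]a, b[ -> cderivable f x) ->
  (forall x, x \in `]a, b[ -> Normc.normc (cderivn 1 f x) <= K) ->
  abs_continuous a b f.
Proof.
move=> df fK; apply: (@lipschitz_abs_continuous _ _ _ _ (K + K)).
move=> x y; rewrite !in_itv /= => /andP[ax _] /andP[_ yb] xy.
have lip (g : R -> R) : (forall t, t \in `]a, b[ -> derivable g t 1) ->
    (forall t, t \in `]a, b[ -> `|derive1 g t| <= K) ->
    `|g y - g x| <= K * (y - x).
  move=> dg gK.
  have xyab t : t \in `[x, y] -> t \in `]a, b[.
    by rewrite !in_itv /= => /andP[xt ty]; rewrite (lt_le_trans ax) ?(le_lt_trans ty).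
  have [||c cxy ->] := @MVT_segment _ g (derive1 g) x y xy.
  - move=> t txy; rewrite derive1E; apply: derivableP; apply/dg/xyab.
    exact: subset_itv_oo_cc txy.
  - by apply: derivable_within_continuous => t /xyab /dg.
  rewrite normrM (ger0_norm (_ : 0 <= y - x)) ?subr_ge0 //.
  by apply: ler_wpM2r; rewrite ?subr_ge0 // gK // xyab.
have re := lip (reC f) (fun t h => (df t h).1)
  (fun t h => le_trans (Re_le_normc (cderivn 1 f t)) (fK t h)).
have im := lip (imC f) (fun t h => (df t h).2)
  (fun t h => le_trans (Im_le_normc (cderivn 1 f t)) (fK t h)).
apply: le_trans (normc_le_ReIm _) _; rewrite mulrDl; apply: le_trans (lerD re im).
by rewrite /reC /imC; case: (f y); case: (f x).
Qed.

End Sobolev_functions.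

(** * Regularity of the lower derivatives and the embedding into bounded functions *)

Section Sobolev_regularity.
Variables (R : realType) (a b : R) (p : \bar R).
Hypotheses (ab : a < b) (p1 : (1 <= p)%E).
Implicit Types (f y : R -> R[i]) (k s : nat) (N : R).

(* The sup norm is controlled by the oscillation, at most twice the L1 norm of
   the derivative, and by the mean of |f|. *)
Lemma abs_continuous_sup_bound N : exists C : R, forall f,
  abs_continuous a b f -> Lebesgue_measurable a b (cderivn 1 f) ->
  (Lpnorm a b p f <= N%:E)%E -> (Lpnorm a b p (cderivn 1 f) <= N%:E)%E ->
  forall x, x \in `]a, b[ -> Normc.normc (f x) <= C.
Proof.
have [C [C0 HC]] := @Lpnorm_integral_bound _ a b p N p1.
exists (C / (b - a) + (C + C)) => f fac mf' fN f'N x xab.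
have int_f := HC _ (abs_continuous_measurable fac) fN.
have osc z : z \in `]a, b[ -> Normc.normc (f x - f z) <= C + C.
  move=> zab; rewrite -lee_fin; apply: le_trans (abs_continuous_increment fac zab xab) _.
  by rewrite EFinD; apply: leeD; exact: HC.
rewrite -lerBlDr; have [/le_trans->//|m0] := leP (Normc.normc (f x) - (C + C)) 0.
  by rewrite divr_ge0 // subr_ge0 ltW.
rewrite ler_pdivlMr ?subr_gt0 // -lee_fin; apply: le_trans int_f.
(* By the oscillation bound, |f| is at least |f x| - 2C on the whole interval; integrating this
   constant leads to the term C / (b - a). *)
have -> : (((Normc.normc (f x) - (C + C)) * (b - a))%:E =
    \int[lebesgue_measure]_(z in `]a, b[) (Normc.normc (f x) - (C + C))%:E)%E.
  rewrite integral_cst // EFinM; congr (_ * _)%E.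
  have := lebesgue_measure_itv `]a, b[; rewrite /= lte_fin ab EFinB => <-.
  by [].
rewrite integral_mkcond [leRHS]integral_mkcond.
apply: (@ge0_ae_le_integral _ _ R lebesgue_measure).
- by move=> t; rewrite patchE; case: ifP; rewrite // lee_fin ltW.
- by move=> t; rewrite patchE; case: ifP; rewrite // lee_fin normc_ge0.
apply: nearW => t; rewrite !patchE; case: ifPn => // /set_mem /= /osc ft.
rewrite lee_fin lerBlDr.
apply: le_trans (lerD (lexx _) ft).
by apply: le_trans (le_normcD _ _); rewrite addrC subrK.
Qed.

(** Here f is not assumed to lie in L_p: this is what the bound serves to prove for the lower
    derivatives. The value at the midpoint takes the place of the mean. *)
Lemma abs_continuous_bounded f : abs_continuous a b f ->
  Lp a b p (cderivn 1 f) ->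
  exists K : R, forall x, x \in `]a, b[ -> Normc.normc (f x) <= K.
Proof.
move=> fac [mf' f'fin]; pose N := fine (Lpnorm a b p (cderivn 1 f)).
have NE : (Lpnorm a b p (cderivn 1 f) <= N%:E)%E.
  by rewrite fineK // ge0_fin_numE // Lpnorm_ge0.
have [C [C0 HC]] := @Lpnorm_integral_bound _ a b p N p1.
pose x0 := (a + b) / 2.
have x0ab : x0 \in `]a, b[ by rewrite in_itv /= /x0 !midf_lt.
exists (Normc.normc (f x0) + (C + C)) => x xab.
apply: (@le_trans _ _ (Normc.normc (f x0) + Normc.normc (f x - f x0))).
  by apply: le_trans (le_normcD _ _); rewrite addrC subrK.
rewrite lerD2l -lee_fin; apply: le_trans (abs_continuous_increment fac x0ab xab) _.
by rewrite EFinD; apply: leeD; exact: HC.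
Qed.

Lemma Sobolev_Lp k y : Sobolev a b k p y -> Lp a b p (cderivn k y).
Proof.
case: k => [|k []//] /=; rewrite (_ : cderivn 0 y = y) //.
by apply/funext => x; rewrite /cderivn /= /reC /imC; case: (y x).
Qed.

Lemma Sobolev_cderivable k y s : Sobolev a b k p y -> (s.+1 < k)%N ->
  forall x, x \in `]a, b[ -> cderivable (cderivn s y) x.
Proof. by case: k => // k [dy _ _] sk; apply: dy. Qed.

(** The definition of [Sobolev] grants both properties at the top order only. They descend: an
    absolutely continuous derivative with next derivative in L_p is bounded, so the derivative one
    order below is Lipschitz, hence absolutely continuous. *)
Lemma Sobolev_abs_continuous k y s : Sobolev a b k p y -> (s < k)%N ->
  abs_continuous a b (cderivn s y) /\ Lp a b p (cderivn s.+1 y).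
Proof.
move=> Sy; have dy := Sobolev_cderivable Sy; have := Sobolev_Lp Sy.
case: k Sy dy => [_ _ _|k [_ acy _] dy Lpy sk]; first by rewrite ltn0.
(* Turns the descent in s into an induction on the distance from the top order. *)
have -> : s = (k - (k - s))%N by rewrite subKn.
elim: (k - s)%N (leq_subr s k) => [|t IH] tk; first by rewrite subn0.
have [ac' Lp'] := IH (ltnW tk).
have tE : (k - t)%N = (k - t.+1).+1 by rewrite subnS prednK // subn_gt0.
have [K HK] := abs_continuous_bounded ac' Lp'.
rewrite tE in HK ac'; split.
  apply: (@bounded_cderiv_abs_continuous _ _ _ (cderivn (k - t.+1) y) K) => //.
  by apply: dy; rewrite -tE ltnS leq_subr.
by split; [exact: abs_continuous_measurable|exact: Lpnorm_bounded HK].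
Qed.

Lemma Sobolev_Lp_lower k y s : Sobolev a b k p y -> (s <= k)%N ->
  Lp a b p (cderivn s y).
Proof.
move=> Sy; rewrite leq_eqVlt => /predU1P[->|sk]; first exact: Sobolev_Lp.
have [ac Lp'] := Sobolev_abs_continuous Sy sk.
have [K HK] := abs_continuous_bounded ac Lp'.
by split; [exact: abs_continuous_measurable|exact: Lpnorm_bounded HK].
Qed.

Lemma Sobolev_ae_cderivable k y s : Sobolev a b k p y -> (s < k)%N ->
  {ae lebesgue_measure, forall x, x \in `]a, b[ -> cderivable (cderivn s y) x}.
Proof. by move=> Sy /(Sobolev_abs_continuous Sy)[/abs_continuous_cderivable]. Qed.

Lemma Sobolev_norm_ge0 k y : (0 <= Sobolev_norm a b k p y)%E.
Proof. by apply: sume_ge0 => s _; exact: Lpnorm_ge0. Qed.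

Lemma Sobolev_norm_fin k y : Sobolev a b k p y -> (Sobolev_norm a b k p y < +oo)%E.
Proof.
move=> Sy; rewrite lte_sum_pinfty // => s _.
by have [_] := @Sobolev_Lp_lower k y s Sy (ltn_ord s).
Qed.

Lemma Lpnorm_le_Sobolev_norm k y s : (s <= k)%N ->
  (Lpnorm a b p (cderivn s y) <= Sobolev_norm a b k p y)%E.
Proof.
move=> sk; rewrite /Sobolev_norm (bigD1 (inord s)) //= inordK // leeDl //.
by apply: sume_ge0 => i _; exact: Lpnorm_ge0.
Qed.

(** C serves all k and s: for s < k, the L_p norms of the derivatives of orders s and s + 1 are both
    summands of the Sobolev norm. *)
Lemma Sobolev_embedding N : exists C : R, forall k y s, Sobolev a b k p y ->
  (Sobolev_norm a b k p y <= N%:E)%E -> (s < k)%N ->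
  forall x, x \in `]a, b[ -> Normc.normc (cderivn s y x) <= C.
Proof.
have [C HC] := abs_continuous_sup_bound N; exists C => k y s Sy yN sk x xab.
have [ac [my' _]] := Sobolev_abs_continuous Sy sk.
apply: HC ac my' _ _ x xab; apply: le_trans yN.
  exact/Lpnorm_le_Sobolev_norm/ltnW.
exact: (@Lpnorm_le_Sobolev_norm k y s.+1).
Qed.

End Sobolev_regularity.

(** * Jets and Leibniz' formula *)

Section complex_derivative.
Variable R : realType.
Implicit Types (f g : R -> R[i]) (x : R) (z l : R[i]).

Definition is_cderive f x l :=
  is_derive x 1 (reC f) (complex.Re l) /\ is_derive x 1 (imC f) (complex.Im l).

Lemma is_cderive_eq f x l : is_cderive f x l -> cderivn 1 f x = l.
Proof.
by case: l => u v [[_ /= hu] [_ /= hv]]; rewrite /cderivn /= !derive1E hu hv.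
Qed.

Lemma cderivable_is_cderive f x : cderivable f x -> is_cderive f x (cderivn 1 f x).
Proof.
move=> [dre dim]; split; rewrite /= derive1E.
  exact: derivableP dre.
exact: derivableP dim.
Qed.

Lemma near_eq_is_cderive f g x l :
  (\near x, f x = g x) -> is_cderive f x l -> is_cderive g x l.
Proof.
move=> fg [re im]; split.
  by apply: near_eq_is_derive re; apply: filterS fg => t; rewrite /reC => ->.
by apply: near_eq_is_derive im; apply: filterS fg => t; rewrite /imC => ->.
Qed.

Lemma is_cderive_cst z x : is_cderive (fun=> z) x 0.
Proof. by split; exact: is_derive_cst. Qed.

Lemma is_cderiveD f g x l l' : is_cderive f x l -> is_cderive g x l' ->
  is_cderive (fun t => f t + g t) x (l + l').
Proof.
move=> [fre fim] [gre gim]; split.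
  rewrite (_ : reC _ = reC f \+ reC g); last first.
    by apply/funext => t; rewrite /reC /=; case: (f t); case: (g t).
  rewrite (_ : complex.Re _ = complex.Re l + complex.Re l'); last first.
    by case: (l); case: (l').
  exact: is_deriveD.
rewrite (_ : imC _ = imC f \+ imC g); last first.
  by apply/funext => t; rewrite /imC /=; case: (f t); case: (g t).
rewrite (_ : complex.Im _ = complex.Im l + complex.Im l'); last first.
  by case: (l); case: (l').
exact: is_deriveD.
Qed.

Lemma is_cderiveM f g x l l' : is_cderive f x l -> is_cderive g x l' ->
  is_cderive (fun t => f t * g t) x (l * g x + f x * l').
Proof.
move=> [fre fim] [gre gim]; split.
  rewrite (_ : reC _ = reC f * reC g - imC f * imC g); last first.
    by apply/funext => t; rewrite !fctE /reC /imC /=; case: (f t); case: (g t).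
  apply: (is_derive_eq (is_deriveB (is_deriveM fre gre) (is_deriveM fim gim))).
  rewrite /reC /imC.
  case: (f x); case: (g x); case: (l); case: (l') => * /=.
  by rewrite /GRing.scale /=; ring.
rewrite (_ : imC _ = reC f * imC g + imC f * reC g); last first.
  by apply/funext => t; rewrite !fctE /reC /imC /=; case: (f t); case: (g t).
apply: (is_derive_eq (is_deriveD (is_deriveM fre gim) (is_deriveM fim gre))).
rewrite /reC /imC.
case: (f x); case: (g x); case: (l); case: (l') => * /=.
by rewrite /GRing.scale /=; ring.
Qed.

Lemma is_cderive_sum (I : Type) (s : seq I) (F : I -> R -> R[i]) x (L : I -> R[i]) :
  (forall i, is_cderive (F i) x (L i)) ->
  is_cderive (fun t => \sum_(i <- s) F i t) x (\sum_(i <- s) L i).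
Proof.
move=> FL; elim: s => [|i s IH].
  rewrite big_nil; under eq_fun do rewrite big_nil; exact: is_cderive_cst.
by rewrite big_cons; under eq_fun do rewrite big_cons; exact: is_cderiveD.
Qed.

End complex_derivative.

Definition leibniz_sum (A : pzRingType) (F H : nat -> A) (s : nat) : A :=
  \sum_(i < s.+1) 'C(s, i)%:R * (F i * H (s - i)%N).

(** The left-hand side is what the product rule produces from [leibniz_sum F H s] term by term;
    Pascal's rule regroups it. *)
Lemma leibniz_sumS (A : pzRingType) (F H : nat -> A) (s : nat) :
  \sum_(i < s.+1) 'C(s, i)%:R * (F i.+1 * H (s - i)%N + F i * H (s - i).+1) =
  leibniz_sum F H s.+1.
Proof.
rewrite /leibniz_sum [RHS]big_ord_recl /= bin0 subn0.
under [in RHS]eq_bigr do rewrite /bump /= add1n binS natrD mulrDl subSS.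
rewrite big_split /= addrA.
under eq_bigr do rewrite mulrDr; rewrite big_split /= addrC; congr (_ + _).
rewrite big_ord_recl /= bin0 subn0; congr (_ + _).
rewrite [RHS]big_ord_recr /= bin_small // mul0r addr0.
by apply: eq_bigr => i _; rewrite /bump /= add1n -subSn.
Qed.

Section jets.
Variables (R : realType) (a b : R).
Implicit Types (f y : R -> R[i]) (F H : nat -> R -> R[i]) (k s : nat).

(* F 0 is a function of W^k type on ]a, b[, with derivatives F 1, ..., F k: the
   last differentiation only holds almost everywhere. *)
Definition jet k F : Prop :=
  [/\ forall s, (s.+1 < k)%N -> forall x, x \in `]a, b[ ->
        is_cderive (F s) x (F s.+1 x),
      forall s, (s < k)%N -> {ae lebesgue_measure, forall x, x \in `]a, b[ ->
        is_cderive (F s) x (F s.+1 x)} &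
      forall s, (s <= k)%N -> Lebesgue_measurable a b (F s)].

(** Differentiating once more at x requires the equality of the lower derivatives in a neighbourhood
    of x. It holds on all of []a, b[] below order k; at order k it survives almost everywhere
    only. *)
Lemma jet_cderivn k F : jet k F ->
  (forall s, (s < k)%N -> forall x, x \in `]a, b[ -> cderivn s (F 0%N) x = F s x) /\
  (forall s, (s <= k)%N -> {ae lebesgue_measure, forall x, x \in `]a, b[ ->
     cderivn s (F 0%N) x = F s x}).
Proof.
move=> [dF aeF _].
have F0 x : cderivn 0 (F 0%N) x = F 0%N x.
  by rewrite /cderivn /= /reC /imC; case: (F 0%N x).
have step s x : (forall t, t \in `]a, b[ -> cderivn s (F 0%N) t = F s t) ->
    x \in `]a, b[ -> is_cderive (F s) x (F s.+1 x) ->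
    cderivn s.+1 (F 0%N) x = F s.+1 x.
  move=> Es xab dFs; rewrite -[LHS]/(cderivn 1 (cderivn s (F 0%N)) x).
  apply: is_cderive_eq; apply: near_eq_is_cderive dFs.
  by have := near_in_itvoo xab; apply: filterS => t /Es.
have everywhere s : (s < k)%N -> forall x, x \in `]a, b[ -> cderivn s (F 0%N) x = F s x.
  elim: s => [|s IH] sk x xab; first exact: F0.
  by apply: step => //; [apply: IH; exact: ltnW|exact: dF].
split=> // -[|s] sk; first by apply: nearW => x _; exact: F0.
apply: filterS (aeF s sk) => x dx xab.
by apply: step => //; [exact: everywhere|exact: dx].
Qed.

Lemma jet_eq k F H : jet k F -> (forall s x, F s x = H s x) -> jet k H.
Proof. by move=> jF FH; have <- : F = H by apply/funext => s; exact/funext. Qed.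

Lemma jet_shift j k K F : (j + k <= K)%N -> jet K F -> jet k (fun s => F (j + s)%N).
Proof.
move=> jk [dF aeF mF]; split=> s sk.
- move=> x xab; rewrite addnS; apply: dF => //.
  by apply: leq_trans jk; rewrite -addnS -addnS leq_add2l.
- rewrite addnS; apply: aeF.
  by apply: leq_trans jk; rewrite -addnS leq_add2l.
- by apply: mF; apply: leq_trans jk; rewrite leq_add2l.
Qed.

Lemma jet_cst k (z : R[i]) : jet k (fun s _ => if s == 0%N then z else 0).
Proof.
split=> s _; [move=> x _|apply: nearW => x _|exact: Lebesgue_measurable_cst];
  exact: is_cderive_cst.
Qed.

Lemma jetD k F H : jet k F -> jet k H -> jet k (fun s x => F s x + H s x).
Proof.
move=> [dF aeF mF] [dH aeH mH]; split=> s sk.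
- by move=> x xab; apply: is_cderiveD; [exact: dF|exact: dH].
- apply: filterS2 (aeF s sk) (aeH s sk) => x dx dx' xab.
  by apply: is_cderiveD; [exact: dx|exact: dx'].
- by apply: Lebesgue_measurableD; [exact: mF|exact: mH].
Qed.

Lemma jet_sum k (I : Type) (r : seq I) (F : I -> nat -> R -> R[i]) :
  (forall i, jet k (F i)) -> jet k (fun s x => \sum_(i <- r) F i s x).
Proof.
move=> jF; elim: r => [|i r IH].
  apply: jet_eq (jet_cst k 0) _ => s x; rewrite big_nil; by case: eqP.
by apply: jet_eq (jetD (jF i) IH) _ => s x; rewrite big_cons.
Qed.

Lemma jetM k F H : jet k F -> jet k H ->
  jet k (fun s x => leibniz_sum (F^~ x) (H^~ x) s).
Proof.
move=> [dF aeF mF] [dH aeH mH].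
have step s x : (forall i, (i <= s)%N -> is_cderive (F i) x (F i.+1 x)) ->
    (forall i, (i <= s)%N -> is_cderive (H i) x (H i.+1 x)) ->
    is_cderive (fun t => leibniz_sum (F^~ t) (H^~ t) s) x
      (leibniz_sum (F^~ x) (H^~ x) s.+1).
  move=> dFx dHx; rewrite -leibniz_sumS; apply: is_cderive_sum => i.
  have := is_cderiveM (is_cderive_cst 'C(s, i)%:R x)
    (is_cderiveM (dFx i _) (dHx (s - i)%N _)).
  by rewrite mul0r add0r; apply; rewrite ?leq_subr // -ltnS.
split=> s sk.
- move=> x xab; apply: step => i si; [apply: dF|apply: dH] => //;
    by apply: leq_ltn_trans sk; rewrite ltnS.
- have aeF' : {ae lebesgue_measure, forall x, x \in `]a, b[ ->
      forall i, (i <= s)%N -> is_cderive (F i) x (F i.+1 x) /\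
        is_cderive (H i) x (H i.+1 x)}.
    (* The order i is moved outside so that the null sets of all orders up to s can be united. *)
    have : {ae lebesgue_measure, forall x, forall i, (i <= s)%N -> x \in `]a, b[ ->
        is_cderive (F i) x (F i.+1 x) /\ is_cderive (H i) x (H i.+1 x)}.
      apply/ae_foralln => i; have [si|is_] := leqP i s; last first.
        by apply: nearW.
      have ik := leq_ltn_trans si sk.
      by apply: filterS2 (aeF i ik) (aeH i ik) => x h1 h2 _ xab; split; auto.
    by apply: filterS => x Hx xab i si; exact: Hx.
  by apply: filterS aeF' => x Hx xab; apply: step => i si; case: (Hx xab i si).
- rewrite /leibniz_sum; apply: Lebesgue_measurable_sum => i.
  apply: Lebesgue_measurableM; first exact: Lebesgue_measurable_cst.
  have si : (i <= s)%N by rewrite -ltnS.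
  apply: Lebesgue_measurableM; [apply: mF|apply: mH].
    exact: leq_trans sk.
  exact: leq_trans (leq_subr _ _) sk.
Qed.

Lemma jetZ k (z : R[i]) F : jet k F -> jet k (fun s x => z * F s x).
Proof.
move=> [dF aeF mF].
have step s x : is_cderive (F s) x (F s.+1 x) ->
    is_cderive (fun t => z * F s t) x (z * F s.+1 x).
  by move=> /(is_cderiveM (is_cderive_cst z x)); rewrite mul0r add0r.
split=> s sk.
- by move=> x xab; apply/step/dF.
- by apply: filterS (aeF s sk) => x dx xab; exact/step/dx.
- by apply: Lebesgue_measurableM; [exact: Lebesgue_measurable_cst|exact: mF].
Qed.

Lemma jetB k F H : jet k F -> jet k H -> jet k (fun s x => F s x - H s x).
Proof.
move=> jF jH; apply: jet_eq (jetD jF (jetZ (-1) jH)) _ => s x.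
by rewrite mulN1r.
Qed.

Variables (p : \bar R).
Hypotheses (ab : a < b) (p1 : (1 <= p)%E).

(** The Sobolev norm read off from the given derivatives; for a jet the two agree, and here
    inequalities follow from pointwise ones. *)
Definition jet_norm k F : \bar R := (\sum_(s < k.+1) Lpnorm a b p (F s))%E.

Lemma Sobolev_norm_jet k F : jet k F -> Sobolev_norm a b k p (F 0%N) = jet_norm k F.
Proof.
move=> /jet_cderivn[_ EF]; apply: eq_bigr => s _; apply: Lpnorm_ae_eq => //.
by apply: EF; rewrite -ltnS.
Qed.

Lemma Sobolev_jet k y : Sobolev a b k p y -> jet k (fun s => cderivn s y).
Proof.
move=> Sy; split=> s sk.
- move=> x xab; apply: (@cderivable_is_cderive _ (cderivn s y)).
  exact: (Sobolev_cderivable Sy).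
- apply: filterS (Sobolev_ae_cderivable ab p1 Sy sk) => x dx xab.
  by apply: (@cderivable_is_cderive _ (cderivn s y)); exact: dx.
- by have [] := Sobolev_Lp_lower ab p1 Sy sk.
Qed.

Lemma jet_normD k F H : jet k F -> jet k H ->
  (jet_norm k (fun s x => F s x + H s x)%R <= jet_norm k F + jet_norm k H)%E.
Proof.
move=> [_ _ mF] [_ _ mH]; rewrite /jet_norm -big_split /=.
by apply: lee_sum => s _; apply: le_LpnormD => //; [apply: mF|apply: mH]; rewrite -ltnS.
Qed.

Lemma jet_norm_eq k F H : (forall s x, F s x = H s x) -> jet_norm k F = jet_norm k H.
Proof. by move=> FH; have <- : F = H by apply/funext => s; exact/funext. Qed.

Lemma jet_norm0 k : jet_norm k (fun _ _ => 0) = 0%E.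
Proof.
apply: big1 => s _; apply/eqP; rewrite eq_le Lpnorm_ge0 andbT.
have := @Lpnorm_ae_le _ a b p 0 (fun=> 0) (fun=> 0) p1 (lexx _)
  (Lebesgue_measurable_cst a b 0).
by rewrite mul0e; apply; apply/nearW => x _; rewrite Normc.normc0 mul0r.
Qed.

Lemma jet_norm_sum k (I : Type) (r : seq I) (F : I -> nat -> R -> R[i]) :
  (forall i, jet k (F i)) ->
  (jet_norm k (fun s x => \sum_(i <- r) F i s x)%R <= \sum_(i <- r) jet_norm k (F i))%E.
Proof.
move=> jF; elim: r => [|i r IH].
  rewrite big_nil (@jet_norm_eq _ _ (fun _ _ => 0)) ?jet_norm0 // => s x.
  by rewrite big_nil.
rewrite big_cons (@jet_norm_eq _ _ (fun s x => F i s x + \sum_(j <- r) F j s x)).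
  apply: le_trans (jet_normD (jF i) (jet_sum r jF)) _.
  by rewrite leeD2l.
by move=> s x; rewrite big_cons.
Qed.

Lemma normc_nat (n : nat) : Normc.normc (n%:R : R[i]) = n%:R :> R.
Proof.
have -> : (n%:R : R[i]) = (n%:R)%:C by rewrite rmorph_nat.
by rewrite /= expr0n addr0 sqrtr_sqr ger0_norm.
Qed.

(** Leibniz' formula with H bounded and only F measured in L_p. In the applications F is a
    difference of coefficients, and H a derivative of y or a monomial. *)
Lemma jet_normM k (C : R) : 0 <= C -> exists2 K : R, 0 <= K &
  forall F H, jet k F -> jet k H ->
  (forall s x, (s <= k)%N -> x \in `]a, b[ -> Normc.normc (H s x) <= C) ->
  (jet_norm k (fun s x => leibniz_sum (F^~ x) (H^~ x) s) <= K%:E * jet_norm k F)%E.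
Proof.
move=> C0; exists (\sum_(s < k.+1) \sum_(i < s.+1) 'C(s, i)%:R * C).
  by apply: sumr_ge0 => s _; apply: sumr_ge0 => i _; rewrite mulr_ge0.
move=> F H [_ _ mF] [_ _ mH] HC; rewrite -sumEFin ge0_sume_distrl; last first.
  by move=> s _; rewrite lee_fin; apply: sumr_ge0 => i _; rewrite mulr_ge0.
apply: lee_sum => s _; rewrite -sumEFin ge0_sume_distrl; last first.
  by move=> i _; rewrite lee_fin mulr_ge0.
have mFH (i : 'I_s.+1) : Lebesgue_measurable a b
    (fun x => 'C(s, i)%:R * (F i x * H (s - i)%N x)).
  have sk : (s <= k)%N by rewrite -ltnS.
  have si : (i <= s)%N by rewrite -ltnS.
  apply: Lebesgue_measurableM; first exact: Lebesgue_measurable_cst.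
  apply: Lebesgue_measurableM; [apply: mF|apply: mH].
    exact: leq_trans sk.
  exact: leq_trans (leq_subr _ _) sk.
apply: le_trans (le_Lpnorm_sum (index_enum _) p1 mFH) _; apply: lee_sum => i _.
have sk : (s <= k)%N by rewrite -ltnS.
have si : (i <= s)%N by rewrite -ltnS.
apply: (@le_trans _ _ (('C(s, i)%:R * C)%:E * Lpnorm a b p (F i))%E).
  apply: Lpnorm_ae_le => //; first by rewrite mulr_ge0.
    by apply: mF; exact: leq_trans sk.
  apply: nearW => x xab; rewrite !Normc.normcM normc_nat -mulrA.
  rewrite ler_wpM2l // mulrC ler_wpM2r ?normc_ge0 // HC //.
  exact: leq_trans (leq_subr _ _) sk.
apply: lee_wpmul2l; first by rewrite lee_fin mulr_ge0.
have ik : (i < k.+1)%N by rewrite ltnS (leq_trans si sk).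
rewrite /jet_norm (bigD1 (Ordinal ik)) //= leeDl //.
by apply: sume_ge0 => j _; exact: Lpnorm_ge0.
Qed.

End jets.

(** * Scalar multiples and monomials in Sobolev spaces *)

Section Sobolev_examples.
Variables (R : realType) (a b : R) (p : \bar R).
Hypotheses (ab : a < b) (p1 : (1 <= p)%E).
Implicit Types (f g y : R -> R[i]) (k s : nat).

Lemma cderivn0 f : cderivn 0 f = f.
Proof. by apply/funext => x; rewrite /cderivn /= /reC /imC; case: (f x). Qed.

Lemma cderivnS s f x : cderivn s.+1 f x = cderivn 1 (cderivn s f) x.
Proof. by []. Qed.

Lemma cderivn_eq_itv f g : (forall x, x \in `]a, b[ -> f x = g x) ->
  forall s x, x \in `]a, b[ -> cderivn s f x = cderivn s g x.
Proof.
move=> fg; elim=> [|s IH] x xab; first by rewrite !cderivn0 fg.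
rewrite (cderivnS s f) (cderivnS s g) /cderivn /= !derive1E; congr (_ +i* _).
  apply: near_eq_derive; have := near_in_itvoo xab; apply: filterS => t tab.
  exact: (congr1 (@complex.Re R) (IH t tab)).
apply: near_eq_derive; have := near_in_itvoo xab; apply: filterS => t tab.
exact: (congr1 (@complex.Im R) (IH t tab)).
Qed.

Lemma Sobolev_norm_eq_itv k f g : (forall x, x \in `]a, b[ -> f x = g x) ->
  Sobolev_norm a b k p f = Sobolev_norm a b k p g.
Proof.
move=> fg; apply: eq_bigr => s _; apply: Lpnorm_ae_eq => //.
by apply: nearW => x xab; exact: cderivn_eq_itv.
Qed.

Lemma smooth_Sobolev k f :
  (forall s x, x \in `]a, b[ -> cderivable (cderivn s f) x) ->
  (forall s, exists K : R, forall x, x \in `]a, b[ ->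
     Normc.normc (cderivn s f x) <= K) ->
  Sobolev a b k p f.
Proof.
move=> df bf.
have acf s : abs_continuous a b (cderivn s f).
  have [K HK] := bf s.+1.
  by apply: (@bounded_cderiv_abs_continuous _ _ _ (cderivn s f) K) => //; exact: df.
have Lpf s : Lp a b p (cderivn s f).
  have [K HK] := bf s.
  by split; [exact: abs_continuous_measurable|exact: Lpnorm_bounded HK].
case: k => [|k]; first by rewrite /= -(cderivn0 f).
by split=> // s _; exact: df.
Qed.

Lemma abs_continuousZ f g (z : R[i]) :
  (forall x, x \in `]a, b[ -> g x = z * f x) ->
  abs_continuous a b f -> abs_continuous a b g.
Proof.
move=> gf fac e e0; pose L := Normc.normc z + 1.
have L0 : 0 < L by rewrite ltr_wpDl // normc_ge0.
have [d d0 fd] := fac _ (divr_gt0 e0 L0); exists d => // N u v uv dis uvd.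
have := fd N u v uv dis uvd; rewrite ltr_pdivlMr // mulr_suml.
apply: le_lt_trans; apply: ler_sum => i _; have [au uvi vb] := uv i.
have uab : u i \in `]a, b[ by rewrite in_itv /= au (le_lt_trans uvi).
have vab : v i \in `]a, b[ by rewrite in_itv /= vb (lt_le_trans au).
rewrite !gf // -mulrBr Normc.normcM mulrC ler_wpM2l ?normc_ge0 //.
by rewrite lerDl.
Qed.

(** Needed to rescale a function into the unit ball over which [op_norm] is a supremum. *)
Lemma SobolevZ k f (z : R[i]) :
  Sobolev a b k p f -> Sobolev a b k p (fun x => z * f x).
Proof.
move=> Sf; have jf := Sobolev_jet ab p1 Sf; have jzf := jetZ z jf.
have [ev ae] := jet_cderivn jzf.
have E : (fun x => z * f x) = (fun x => z * cderivn 0 f x) by rewrite cderivn0.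
have {}Lp : Lp a b p (cderivn k (fun x => z * f x)).
  have Ek := ae k (leqnn k); have [mf ffin] := Sobolev_Lp Sf.
  split.
    apply: (@Lebesgue_measurable_ae_eq _ _ _ (fun x => z * cderivn k f x)).
      by apply: Lebesgue_measurableM => //; exact: Lebesgue_measurable_cst.
    by apply: filterS Ek => x; rewrite E => /[apply] ->.
  apply: (@le_lt_trans _ _ ((Normc.normc z)%:E * Lpnorm a b p (cderivn k f))%E).
    apply: Lpnorm_ae_le => //; first exact: normc_ge0.
    by apply: filterS Ek => x; rewrite E => /[apply] ->; rewrite Normc.normcM.
  by rewrite lte_mul_pinfty // ?lee_fin ?normc_ge0.
case: k Sf jf jzf ev ae Lp => [|k] Sf jf jzf ev ae Lp.
  by rewrite /= -(cderivn0 (fun x => z * f x)).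
case: (Sf) => df acf _; split; last exact: Lp.
- move=> s sk x xab.
  have nearE : \near x, z * cderivn s f x = cderivn s (fun t => z * f t) x.
    have := near_in_itvoo xab; apply: filterS => t tab.
    by rewrite E ev // ltnW.
  have dzf := is_cderiveM (is_cderive_cst z x)
    (@cderivable_is_cderive _ (cderivn s f) x (df s sk x xab)).
  have [dre dim] := near_eq_is_cderive nearE dzf.
  by split; [case: dre => d _; exact: d|case: dim => d _; exact: d].
- by apply: abs_continuousZ acf => x xab; rewrite E ev.
Qed.

Lemma jet_normZ k (z : R[i]) F : jet a b k F ->
  (jet_norm a b p k (fun s x => z * F s x)%R <=
   (Normc.normc z)%:E * jet_norm a b p k F)%E.
Proof.
move=> [_ _ mF]; rewrite ge0_sume_distrr; last by move=> s _; exact: Lpnorm_ge0.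
apply: lee_sum => s _; apply: Lpnorm_ae_le => //; first exact: normc_ge0.
  by apply: mF; rewrite -ltnS.
by apply: nearW => x _; rewrite Normc.normcM.
Qed.

(** The factor 1 / s! makes each derivative again a monomial of this family, the one of order s
    being 1. *)
Definition monomial (s : nat) (x : R) : R := x ^+ s / s`!%:R.

Lemma is_derive_monomial s x :
  is_derive x (1 : R) (monomial s.+1) (monomial s x).
Proof.
have -> : monomial s.+1 = (s.+1)`!%:R^-1 \*: (fun x : R => x ^+ s.+1).
  by apply/funext => t; rewrite /monomial /= /GRing.scale /= mulrC.
apply: DeriveDef; first exact/derivableZ/exprn_derivable.
rewrite deriveZ; last exact: exprn_derivable.
rewrite exp_derive /monomial factS natrM invfM /GRing.scale /= mulr1.
have : s.+1%:R != 0 :> R by rewrite pnatr_eq0.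
move: (s.+1%:R) (s`!%:R^-1) (x ^+ s) => c d t c0.
by field.
Qed.

Lemma derive1n_monomial j s :
  derive1n j (monomial s) = if (j <= s)%N then monomial (s - j) else (fun=> 0).
Proof.
elim: j => [|j IH]; first by rewrite subn0.
rewrite -[LHS]/(derive1 (derive1n j (monomial s))) IH; apply/funext => x.
case: (ltngtP j s) => js /=.
- rewrite -(subnSK js) derive1E; by have [_ ->] := is_derive_monomial (s - j.+1) x.
- by rewrite derive1E; exact: derive_cst.
- rewrite js subnn derive1E.
  have -> : monomial 0 = (fun=> 1).
    by apply/funext => t; rewrite /monomial expr0 fact0 divr1.
  exact: derive_cst.
Qed.

Definition cmonomial (s : nat) (x : R) : R[i] := (monomial s x)%:C.

Lemma cderivn_cmonomial j s :
  cderivn j (cmonomial s) = if (j <= s)%N then cmonomial (s - j) else (fun=> 0).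
Proof.
have im0 : derive1n j (imC (cmonomial s)) = fun=> 0.
  elim: j => // j IH; rewrite -[LHS]/(derive1 (derive1n j (imC (cmonomial s)))) IH.
  by apply/funext => x; rewrite derive1E; exact: derive_cst.
apply/funext => x; rewrite /cderivn im0 [X in derive1n _ X](_ : _ = monomial s) //.
by rewrite derive1n_monomial; case: ifP.
Qed.

Lemma cmonomial_bounded s : exists K : R, forall x, x \in `]a, b[ ->
  Normc.normc (cmonomial s x) <= K.
Proof.
exists ((`|a| + `|b|) ^+ s) => x; rewrite in_itv /= => /andP[ax xb].
rewrite expr0n addr0 sqrtr_sqr normrM normfV normrX normr_nat.
rewrite ler_pdivrMr ?ltr0n ?fact_gt0 //.
apply: (@le_trans _ _ ((`|a| + `|b|) ^+ s)).
  apply: lerXn2r; rewrite ?nnegrE ?addr_ge0 //.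
  have h1 := ler_norm b; have h2 := ler_norm (- a); rewrite normrN in h2.
  have h3 := normr_ge0 a; have h4 := normr_ge0 b.
  by rewrite ler_norml; apply/andP; split; lra.
by rewrite ler_peMr ?exprn_ge0 ?addr_ge0 // ler1n fact_gt0.
Qed.

Lemma cmonomial_cderivable s x : cderivable (cmonomial s) x.
Proof.
split; last exact: derivable_cst.
rewrite [X in derivable X](_ : _ = monomial s) //.
case: s => [|s]; last by case: (is_derive_monomial s x).
have -> : monomial 0 = (fun=> 1).
  by apply/funext => t; rewrite /monomial expr0 fact0 divr1.
exact: derivable_cst.
Qed.

Lemma cst0_cderivable x : cderivable (fun=> 0 : R[i]) x.
Proof. by split; exact: derivable_cst. Qed.

Lemma cmonomial_Sobolev k s : Sobolev a b k p (cmonomial s).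
Proof.
apply: smooth_Sobolev => j; rewrite cderivn_cmonomial; case: ifP => _.
- by move=> x _; exact: cmonomial_cderivable.
- by move=> x _; exact: cst0_cderivable.
- exact: cmonomial_bounded.
- by exists 0 => x _; rewrite Normc.normc0.
Qed.

Lemma cderivn_cst0 j : cderivn j (fun=> 0 : R[i]) = (fun=> 0).
Proof.
have d0 : derive1n j (fun=> 0 : R) = fun=> 0.
  elim: j => // j IH; rewrite -[LHS]/(derive1 (derive1n j (fun=> 0))) IH.
  by apply/funext => x; rewrite derive1E; exact: derive_cst.
by apply/funext => x; rewrite /cderivn /reC /imC /= d0.
Qed.

Lemma cst0_Sobolev k : Sobolev a b k p (fun=> 0).
Proof.
apply: smooth_Sobolev => j; rewrite cderivn_cst0.
- by move=> x _; exact: cst0_cderivable.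
- by exists 0 => x _; rewrite Normc.normc0.
Qed.

Lemma Sobolev_norm_cst0 k : Sobolev_norm a b k p (fun=> 0) = 0%E.
Proof.
rewrite -(@jet_norm0 _ a b p p1 k); apply: eq_bigr => s _.
by rewrite cderivn_cst0.
Qed.

End Sobolev_examples.

(** * Differential operators *)

Section differential_operators.
Variables (R : realType) (a b : R) (p : \bar R) (n m r : nat).
Hypotheses (ab : a < b) (p1 : (1 <= p)%E).
Implicit Types (f g : R -> R[i]) (y : R -> 'cV[R[i]]_m).
Implicit Types (A B : 'I_r -> R -> 'M[R[i]]_m).

Definition diff_jet f g (s : nat) (x : R) : R[i] := cderivn s f x - cderivn s g x.

Lemma jet_diff_jet k f g : Sobolev a b k p f -> Sobolev a b k p g ->
  jet a b k (diff_jet f g).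
Proof. by move=> Sf Sg; apply: jetB; exact: (Sobolev_jet ab p1). Qed.

Lemma diff_jet0 f g : diff_jet f g 0 = (fun x => f x - g x).
Proof. by apply/funext => x; rewrite /diff_jet !cderivn0. Qed.

Lemma Sobolev_norm_diff_jet k f g : Sobolev a b k p f -> Sobolev a b k p g ->
  Sobolev_norm a b k p (fun x => f x - g x) = jet_norm a b p k (diff_jet f g).
Proof.
move=> Sf Sg; rewrite -diff_jet0; apply: Sobolev_norm_jet => //.
exact: jet_diff_jet.
Qed.

(** Both operators have the same leading term [y^(r)], which cancels. *)
Lemma diff_opB_entry A B y x i c :
  (diff_op A y x - diff_op B y x) i c =
  \sum_(j < r) \sum_(l < m)
    (A j x i l - B j x i l) * cderivn j (fun t => y t l c) x.
Proof.
rewrite /diff_op !mxE opprD addrACA subrr add0r !summxE -sumrB.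
apply: eq_bigr => j _; rewrite !mxE -sumrB; apply: eq_bigr => l _.
by rewrite !mxE mulrBl.
Qed.

(** The derivative of order s of an entry of the difference of the two operators at y, expanded by
    Leibniz' formula. *)
Definition operator_jet A B y (i : 'I_m) (c : 'I_1) (s : nat) (x : R) : R[i] :=
  \sum_(j < r) \sum_(l < m)
    leibniz_sum (fun t => diff_jet (fun x => A j x i l) (fun x => B j x i l) t x)
      (fun t => cderivn (j + t) (fun x => y x l c) x) s.

Lemma leibniz_sum0 (T : pzRingType) (F H : nat -> T) :
  leibniz_sum F H 0 = F 0%N * H 0%N.
Proof. by rewrite /leibniz_sum big_ord1 bin0 mul1r subnn. Qed.

Lemma operator_jet0 A B y i c : operator_jet A B y i c 0 =
  (fun x => (diff_op A y x - diff_op B y x) i c).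
Proof.
apply/funext => x; rewrite diff_opB_entry; apply: eq_bigr => j _.
apply: eq_bigr => l _; rewrite leibniz_sum0 addn0.
by rewrite diff_jet0.
Qed.

Lemma Sobolev_derivative_jet f (j : 'I_r) : Sobolev a b (n + r) p f ->
  jet a b n (fun t => cderivn (j + t) f).
Proof.
move=> Sf; apply: (@jet_shift _ _ _ j n (n + r) (fun s => cderivn s f)).
  by rewrite addnC leq_add2l ltnW.
exact: (Sobolev_jet ab p1).
Qed.

Lemma jet_operator_jet A B y i c :
  (forall j, mxSobolev a b n p (A j)) -> (forall j, mxSobolev a b n p (B j)) ->
  mxSobolev a b (n + r) p y -> jet a b n (operator_jet A B y i c).
Proof.
move=> SA SB Sy; apply: jet_sum => j; apply: jet_sum => l.
have jd := jet_diff_jet (SA j i l) (SB j i l).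
exact: jetM jd (Sobolev_derivative_jet j (Sy l c)).
Qed.

Lemma operator_norm_bound (C : R) : 0 <= C -> exists2 K : R, 0 <= K &
  forall A B y, (forall j, mxSobolev a b n p (A j)) ->
  (forall j, mxSobolev a b n p (B j)) -> mxSobolev a b (n + r) p y ->
  (forall s l c x, (s < n + r)%N -> x \in `]a, b[ ->
     Normc.normc (cderivn s (fun t => y t l c) x) <= C) ->
  (mxSobolev_norm a b n p (fun x => diff_op A y x - diff_op B y x)%R <=
   K%:E * \sum_(j < r) mxSobolev_norm a b n p (fun x => A j x - B j x)%R)%E.
Proof.
move=> C0; have [K K0 HK] := @jet_normM _ a b p p1 n C C0.
exists K => // A B y SA SB Sy yC.
rewrite ge0_sume_distrr; last first.
  move=> j _; apply: sume_ge0 => i _; apply: sume_ge0 => l _.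
  exact: Sobolev_norm_ge0.
rewrite /mxSobolev_norm.
apply: (@le_trans _ _ (\sum_(i < m) \sum_(j < r) \sum_(l < m)
    K%:E * Sobolev_norm a b n p (fun x => (A j x - B j x)%R i l))%E).
  apply: lee_sum => i _; rewrite big_ord1 -operator_jet0.
  rewrite Sobolev_norm_jet //; last exact: jet_operator_jet.
  have jd j l := jet_diff_jet (SA j i l) (SB j i l).
  have jy j l := Sobolev_derivative_jet j (Sy l ord0).
  apply: le_trans (jet_norm_sum p1 (index_enum 'I_r) _) _.
    by move=> j; apply: jet_sum => l; exact: jetM.
  apply: lee_sum => j _.
  apply: le_trans (jet_norm_sum p1 (index_enum 'I_m) _) _.
    by move=> l; exact: jetM.
  apply: lee_sum => l _.
  under [X in Sobolev_norm _ _ _ _ X]eq_fun do rewrite !mxE.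
  rewrite (Sobolev_norm_diff_jet (SA j i l) (SB j i l)).
  apply: (HK _ (fun t => cderivn (j + t) (fun x => y x l ord0)) (jd j l) (jy j l)).
  move=> s x sn xab.
  apply: yC => //; rewrite addnC.
  (* From s <= n and j < r, the order j + s is below n + r. *)
  by apply: (leq_ltn_trans (leq_add sn (leqnn _))); rewrite ltn_add2l.
rewrite exchange_big /=; apply: lee_sum => j _.
rewrite ge0_sume_distrr; last first.
  by move=> i _; apply: sume_ge0 => l _; exact: Sobolev_norm_ge0.
apply: lee_sum => i _; rewrite ge0_sume_distrr // => l _.
exact: Sobolev_norm_ge0.
Qed.

Lemma mxSobolev_norm_ge0 k (q : nat) (F : R -> 'M[R[i]]_(m, q)) :
  (0 <= mxSobolev_norm a b k p F)%E.
Proof.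
by apply: sume_ge0 => i _; apply: sume_ge0 => j _; exact: Sobolev_norm_ge0.
Qed.

Lemma Sobolev_norm_le_mx k (q : nat) (F : R -> 'M[R[i]]_(m, q)) i j :
  (Sobolev_norm a b k p (fun x => F x i j) <= mxSobolev_norm a b k p F)%E.
Proof.
rewrite /mxSobolev_norm (bigD1 i) //= (bigD1 j) //= -addeA leeDl //.
apply: adde_ge0; apply: sume_ge0 => i' _; first exact: Sobolev_norm_ge0.
by apply: sume_ge0 => j' _; exact: Sobolev_norm_ge0.
Qed.

Lemma mxSobolev_norm_fin k (q : nat) (F : R -> 'M[R[i]]_(m, q)) :
  mxSobolev a b k p F -> (mxSobolev_norm a b k p F < +oo)%E.
Proof.
move=> SF; apply: lte_sum_pinfty => i _; apply: lte_sum_pinfty => j _.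
exact: Sobolev_norm_fin.
Qed.

(** The embedding with N = 1 bounds the derivatives of all y in the unit ball at once, so one K
    serves them all. *)
Lemma op_norm_bound : exists2 K : R, 0 <= K &
  forall A B, (forall j, mxSobolev a b n p (A j)) ->
  (forall j, mxSobolev a b n p (B j)) ->
  (op_norm a b (n + r) n p (fun y x => diff_op A y x - diff_op B y x)%R <=
   K%:E * \sum_(j < r) mxSobolev_norm a b n p (fun x => A j x - B j x)%R)%E.
Proof.
have [C HC] := @Sobolev_embedding _ a b p ab p1 1.
have [|K K0 HK] := @operator_norm_bound (Order.max C 0).
  by rewrite le_max lexx orbT.
exists K => // A B SA SB; apply: ge_ereal_sup => _ [y [Sy y1] <-].
apply: HK => // s l c x sn xab; rewrite le_max; apply/orP; left.
have y1' := le_trans (Sobolev_norm_le_mx (n + r) y l c) y1.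
exact: (HC _ _ s (Sy l c) y1' sn x xab).
Qed.

(** The zero function belongs to the unit ball, so the supremum is at least one nonnegative
    value. *)
Lemma op_norm_ge0 (T : (R -> 'cV[R[i]]_m) -> R -> 'cV[R[i]]_m) :
  (0 <= op_norm a b (n + r) n p T)%E.
Proof.
apply: (@le_trans _ _ (mxSobolev_norm a b n p (T (fun=> 0)))).
  exact: mxSobolev_norm_ge0.
have E i (j : 'I_1) : (fun x : R => (0 : 'cV[R[i]]_m) i j) = (fun=> 0).
  by apply/funext => x; rewrite mxE.
apply: ereal_sup_ubound; exists (fun=> 0) => //; split.
  by move=> i j; rewrite E; exact: cst0_Sobolev.
rewrite /mxSobolev_norm big1 // => i _; rewrite big1 // => j _.
by rewrite E Sobolev_norm_cst0.
Qed.

Lemma op_norm_apply A B y :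
  (forall j, mxSobolev a b n p (A j)) -> (forall j, mxSobolev a b n p (B j)) ->
  mxSobolev a b (n + r) p y ->
  (mxSobolev_norm a b n p (fun x => diff_op A y x - diff_op B y x)%R <=
   (fine (mxSobolev_norm a b (n + r) p y) + 1)%:E *
   op_norm a b (n + r) n p (fun y x => diff_op A y x - diff_op B y x)%R)%E.
Proof.
(* Adding 1 to the norm of y allows division by N even if y has norm 0; y / N lies in the unit
   ball. *)
move=> SA SB Sy; set N := fine _ + 1.
have N1 : mxSobolev_norm a b (n + r) p y = (N - 1)%:E.
  by rewrite /N addrK fineK // ge0_fin_numE ?mxSobolev_norm_fin ?mxSobolev_norm_ge0.
have N0 : 0 < N.
  have := mxSobolev_norm_ge0 (n + r) y; rewrite N1 lee_fin subr_ge0.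
  exact: lt_le_trans.
have normcR (t : R) : Normc.normc (t%:C) = `|t|.
  by rewrite /= expr0n addr0 sqrtr_sqr.
pose y' x := (N^-1)%:C *: y x.
have Ey' l c : (fun x => y' x l c) = (fun x => (N^-1)%:C * y x l c).
  by apply/funext => x; rewrite mxE.
clearbody y'.
have Sy' : mxSobolev a b (n + r) p y'.
  by move=> l c; rewrite Ey'; apply: SobolevZ.
have y'1 : (mxSobolev_norm a b (n + r) p y' <= 1)%E.
  apply: (@le_trans _ _ ((N^-1)%:E * mxSobolev_norm a b (n + r) p y)%E).
    rewrite ge0_sume_distrr; last first.
      by move=> l _; apply: sume_ge0 => c _; exact: Sobolev_norm_ge0.
    apply: lee_sum => l _; rewrite ge0_sume_distrr; last first.
      by move=> c _; exact: Sobolev_norm_ge0.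
    apply: lee_sum => c _; rewrite Ey'.
    have jS := Sobolev_jet ab p1 (Sy l c).
    have := jet_normZ p1 (N^-1)%:C jS.
    rewrite normcR gtr0_norm ?invr_gt0 //.
    rewrite -(Sobolev_norm_jet p1 (jetZ _ jS)) -(Sobolev_norm_jet p1 jS).
    by rewrite cderivn0.
  rewrite N1 lee_fin mulrC ler_pdivrMr // mul1r lerBlDr lerDl //.
(* Homogeneity is pointwise on []a, b[], because the orders j < r of the derivatives involved are
   below n + r. *)
have Ty i (c : 'I_1) x : x \in `]a, b[ ->
    (diff_op A y x - diff_op B y x) i c =
    N%:C * (diff_op A y' x - diff_op B y' x) i c.
  move=> xab; rewrite (diff_opB_entry A B y) (diff_opB_entry A B y') mulr_sumr.
  apply: eq_bigr => j _.
  rewrite mulr_sumr; apply: eq_bigr => l _; rewrite Ey' mulrCA; congr (_ * _).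
  have jS := jetZ (N^-1)%:C (Sobolev_jet ab p1 (Sy l c)).
  have [ev _] := jet_cderivn jS.
  have jnr : (j < n + r)%N by rewrite (leq_trans (ltn_ord j)) // leq_addl.
  have := ev j jnr x xab; rewrite cderivn0 => ->.
  by rewrite mulrA -rmorphM /= mulfV ?gt_eqF // rmorph1 mul1r.
apply: (@le_trans _ _ (N%:E * mxSobolev_norm a b n p
    (fun x => diff_op A y' x - diff_op B y' x)%R)%E); last first.
  apply: lee_wpmul2l; first by rewrite lee_fin ltW.
  by apply: ereal_sup_ubound; exists y'.
rewrite ge0_sume_distrr; last first.
  by move=> l _; apply: sume_ge0 => c _; exact: Sobolev_norm_ge0.
apply: lee_sum => i _.
rewrite ge0_sume_distrr; last by move=> c _; exact: Sobolev_norm_ge0.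
apply: lee_sum => c _.
rewrite (Sobolev_norm_eq_itv p1 n (Ty i c)).
have jT := jet_operator_jet i c SA SB Sy'.
have := jet_normZ p1 N%:C jT; rewrite normcR gtr0_norm //.
rewrite -(Sobolev_norm_jet p1 (jetZ _ jT)) -(Sobolev_norm_jet p1 jT).
by rewrite operator_jet0.
Qed.

End differential_operators.

(** * Recovery of the coefficients from monomial test vectors *)

Section coefficient_recovery.
Variables (R : realType) (a b : R) (p : \bar R) (n m r : nat).
Hypotheses (ab : a < b) (p1 : (1 <= p)%E).
Implicit Types (A B : 'I_r -> R -> 'M[R[i]]_m).

Definition monomial_vector (s : nat) (k : 'I_m) (x : R) : 'cV[R[i]]_m :=
  \col_l (if l == k then cmonomial s x else 0).

Lemma monomial_vector_entry s k l c : (fun x => monomial_vector s k x l c) =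
  if l == k then @cmonomial R s else (fun=> 0).
Proof. by apply/funext => x; rewrite mxE; case: ifP. Qed.

Lemma monomial_vector_Sobolev q s k : mxSobolev a b q p (monomial_vector s k).
Proof.
move=> l c; rewrite monomial_vector_entry; case: ifP => _.
  exact: cmonomial_Sobolev.
exact: cst0_Sobolev.
Qed.

(** Derivatives of the monomial of orders above s vanish and that of order s is 1, so the sum over j
    is triangular and can be solved for the term j = s. *)
Lemma coefficient_eq A B (s : 'I_r) (i k : 'I_m) (c : 'I_1) x :
  A s x i k - B s x i k =
  (diff_op A (monomial_vector s k) x - diff_op B (monomial_vector s k) x) i c -
  \sum_(j < r | (j < s)%N) (A j x i k - B j x i k) * cmonomial (s - j) x.
Proof.
rewrite diff_opB_entry.
have inner j : \sum_(l < m) (A j x i l - B j x i l) *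
      cderivn j (fun t => monomial_vector s k t l c) x =
    (A j x i k - B j x i k) * (if (j <= s)%N then cmonomial (s - j) x else 0).
  rewrite (bigD1 k) //= big1 ?addr0 => [|l lk].
    by rewrite monomial_vector_entry eqxx cderivn_cmonomial; case: ifP.
  by rewrite monomial_vector_entry (negbTE lk) cderivn_cst0 mulr0.
under eq_bigr do rewrite inner.
rewrite (bigID (fun j : 'I_r => (j < s)%N)) /= [X in X + _ - _](eq_bigr
  (fun j : 'I_r => (A j x i k - B j x i k) * cmonomial (s - j) x)); last first.
  by move=> j js; rewrite ltnW.
rewrite [X in _ = X - _]addrC addrK (bigD1 s) ?ltnn //= leqnn subnn big1 ?addr0.
  by rewrite /cmonomial /monomial expr0 fact0 divr1 mulr1.
move=> j /andP[js sj]; rewrite leq_eqVlt (negbTE js) orbF.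
by rewrite (negbTE (sj : (j : nat) != s)) mulr0.
Qed.

Lemma cmonomial_uniformly_bounded N : exists2 C : R, 0 <= C &
  forall q x, (q <= N)%N -> x \in `]a, b[ -> Normc.normc (cmonomial q x) <= C.
Proof.
elim: N => [|N [C C0 HC]].
  have [K HK] := cmonomial_bounded a b 0.
  exists (Order.max K 0); first by rewrite le_max lexx orbT.
  by move=> q x; rewrite leqn0 => /eqP -> xab; rewrite le_max HK.
have [K HK] := cmonomial_bounded a b N.+1.
exists (Order.max K C); first by rewrite le_max C0 orbT.
move=> q x; rewrite leq_eqVlt => /predU1P[->|qN] xab; rewrite le_max.
  by rewrite HK.
by rewrite (HC q) ?orbT.
Qed.

(** [coefficient_eq] in norm. K is uniform in A and B, so the right-hand side tends to 0 once the
    lower coefficients converge. *)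
Lemma coefficient_bound (s : 'I_r) : exists2 K : R, 0 <= K &
  forall A B, (forall j, mxSobolev a b n p (A j)) ->
  (forall j, mxSobolev a b n p (B j)) ->
  (mxSobolev_norm a b n p (fun x => A s x - B s x)%R <=
   \sum_(i < m) \sum_(k < m)
     (mxSobolev_norm a b n p (fun x =>
        diff_op A (monomial_vector s k) x - diff_op B (monomial_vector s k) x)%R +
      \sum_(j < r | (j < s)%N)
         K%:E * mxSobolev_norm a b n p (fun x => A j x - B j x)%R))%E.
Proof.
have [C C0 HC] := cmonomial_uniformly_bounded r.
have [K K0 HK] := @jet_normM _ a b p p1 n C C0; exists K => // A B SA SB.
apply: lee_sum => i _; apply: lee_sum => k _.
set y := monomial_vector s k.
have Sy : mxSobolev a b (n + r) p y by exact: monomial_vector_Sobolev.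
pose J0 := operator_jet A B y i ord0.
have jJ0 : jet a b n J0 by exact: (jet_operator_jet ab p1).
pose D (j : 'I_r) := diff_jet (fun x => A j x i k) (fun x => B j x i k).
have jD j : jet a b n (D j).
  by apply: (jet_diff_jet ab p1); [exact: SA|exact: SB].
pose P (j : 'I_r) t := cderivn t (@cmonomial R (s - j)%N).
have jP j : jet a b n (P j).
  by apply: (Sobolev_jet ab p1); exact: cmonomial_Sobolev.
pose Q j t x := leibniz_sum ((D j)^~ x) ((P j)^~ x) t.
have jQ j : jet a b n (Q j) by exact: jetM.
(* [jet_sum] and [jet_norm_sum] sum over a list without a predicate, so the condition j < s goes
   into the list. *)
pose L := [seq j : 'I_r <- index_enum 'I_r | (j < s)%N].
pose S t x := \sum_(j <- L) Q j t x.
have jS : jet a b n S by exact: jet_sum.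
pose J t x := J0 t x + (-1) * S t x.
have jJ : jet a b n J by apply: jetD => //; exact: jetZ.
have EJ : (fun x => (A s x - B s x) i k) = J 0.
  apply/funext => x; rewrite !mxE (coefficient_eq A B s i k ord0 x).
  rewrite /J /J0 operator_jet0 mulN1r; congr (_ - _).
  rewrite /S big_filter; apply: eq_bigr => j _; rewrite /Q leibniz_sum0.
  by rewrite /D diff_jet0 /P cderivn0.
rewrite EJ (Sobolev_norm_jet p1 jJ).
apply: le_trans (jet_normD p1 jJ0 (jetZ (-1) jS)) _; apply: leeD.
  rewrite -(Sobolev_norm_jet p1 jJ0) /J0 operator_jet0.
  exact: (@Sobolev_norm_le_mx _ a b p m n 1
    (fun x => diff_op A y x - diff_op B y x) i ord0).
apply: le_trans (jet_normZ p1 (-1) jS) _.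
have -> : Normc.normc (-1 : R[i]) = 1 by rewrite normcN Normc.normc1.
rewrite mul1e; apply: le_trans (jet_norm_sum p1 L jQ) _.
rewrite big_filter; apply: lee_sum => j js.
apply: (@le_trans _ _ (K%:E * jet_norm a b p n (D j))%E).
  (* The derivatives of the monomial are 0 or monomials of degree at most s < r, all bounded by
     C. *)
  apply: HK => // t x tn xab; rewrite /P cderivn_cmonomial; case: ifP => _.
    apply: HC => //; apply: leq_trans (leq_subr _ _) _.
    by apply: leq_trans (leq_subr _ _) _; exact: ltnW.
  by rewrite Normc.normc0.
apply: lee_wpmul2l; first by rewrite lee_fin.
rewrite -(Sobolev_norm_diff_jet ab p1 (SA j i k) (SB j i k)).
rewrite (_ : (fun x => _) = (fun x => (A j x - B j x) i k)); last first.
  by apply/funext => x; rewrite !mxE.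
exact: (@Sobolev_norm_le_mx _ a b p m n m (fun x => A j x - B j x) i k).
Qed.

End coefficient_recovery.

(** * Limits of nonnegative extended real functions *)

Lemma ge0_cvg_le0 (T : Type) (F : set_system T) {FF : Filter F} (R : realType)
    (u v : T -> \bar R) :
  (forall t, 0 <= u t)%E -> (forall t, u t <= v t)%E ->
  v @ F --> 0%E -> u @ F --> 0%E.
Proof.
move=> u0 uv v0; apply: (squeeze_cvge _ (cvg_cst 0%E) v0).
by apply: nearW => t; rewrite u0 uv.
Qed.

Lemma ge0_cvg_sum0 (T : Type) (F : set_system T) {FF : ProperFilter F} (R : realType)
    (I : Type) (l : seq I) (P : pred I) (u : I -> T -> \bar R) :
  (forall i t, 0 <= u i t)%E -> (forall i, P i -> u i @ F --> 0%E) ->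
  (fun t => \sum_(i <- l | P i) u i t)%E @ F --> 0%E.
Proof.
move=> u0 uc.
have := @cvg_nnesum _ F FF R I l u (fun=> 0%E) P.
rewrite big1 //; apply => // i _.
by apply: nearW => t; exact: u0.
Qed.

Lemma cvge0Z (T : Type) (F : set_system T) {FF : Filter F} (R : realType)
    (K : R) (u : T -> \bar R) :
  u @ F --> 0%E -> (fun t => K%:E * u t)%E @ F --> 0%E.
Proof. by move=> u0; rewrite -(mule0 K%:E); exact: cvgeZl. Qed.

Lemma cvge0D (T : Type) (F : set_system T) {FF : Filter F} (R : realType)
    (u v : T -> \bar R) :
  u @ F --> 0%E -> v @ F --> 0%E -> (fun t => u t + v t)%E @ F --> 0%E.
Proof. by move=> u0 v0; rewrite -(adde0 0%E); exact: cvgeD. Qed.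

Unset Implicit Arguments.
Set Strict Implicit.
Set Printing Implicit Defensive.

Theorem theorem3p1 (R : realType) (a b : R) (n m r : nat) (p : \bar R)
    (M : metricType R) (mu0 : M) (A : M -> 'I_r -> R -> 'M[R[i]]_m) :
  a < b -> (0 < m)%N -> (0 < r)%N -> (1 <= p)%E ->
  (forall (mu : M) (j : 'I_r), mxSobolev a b n p (A mu j)) ->
  [<-> forall j : 'I_r,
         mxSobolev_norm a b n p (fun x => A mu j x - A mu0 j x)
           @[mu --> mu0] --> 0%E;
       op_norm a b (n + r) n p
         (fun y x => diff_op (A mu) y x - diff_op (A mu0) y x)
           @[mu --> mu0] --> 0%E;
       forall y : R -> 'cV[R[i]]_m, mxSobolev a b (n + r) p y ->
         mxSobolev_norm a b n p
           (fun x => diff_op (A mu) y x - diff_op (A mu0) y x)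
           @[mu --> mu0] --> 0%E].
Proof.
move=> ab _ _ p1 SA; tfae.
- move=> coef; have [K K0 HK] := @op_norm_bound R a b p n m r ab p1.
  apply: (ge0_cvg_le0 _ (fun mu => HK (A mu) (A mu0) (SA mu) (SA mu0))).
    by move=> mu; exact: op_norm_ge0.
  apply: cvge0Z.
  apply: (@ge0_cvg_sum0 M (nbhs mu0) _ R 'I_r (index_enum _) xpredT
    (fun j mu => mxSobolev_norm a b n p (fun x => A mu j x - A mu0 j x)%R)).
    by move=> j mu; exact: mxSobolev_norm_ge0.
  by move=> j _; exact: coef.
- move=> opn y Sy.
  apply: (ge0_cvg_le0 _ (fun mu => op_norm_apply ab p1 (SA mu) (SA mu0) Sy)).
    by move=> mu; exact: mxSobolev_norm_ge0.
  exact: cvge0Z.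
- move=> strong j; move sE : (nat_of_ord j) => s.
  (* Strong induction on the order: the bound for coefficient j involves the differences of all
     coefficients of smaller index. *)
  elim/ltn_ind: s j sE => s IH j js.
  have [K K0 HK] := @coefficient_bound R a b p n m r ab p1 j.
  apply: (ge0_cvg_le0 _ (fun mu => HK (A mu) (A mu0) (SA mu) (SA mu0))).
    by move=> mu; exact: mxSobolev_norm_ge0.
  pose u (t : 'I_r) mu :=
    (K%:E * mxSobolev_norm a b n p (fun x => A mu t x - A mu0 t x)%R)%E.
  pose v k mu := mxSobolev_norm a b n p (fun x =>
    diff_op (A mu) (monomial_vector j k) x - diff_op (A mu0) (monomial_vector j k) x)%R.
  have u0 t mu : (0 <= u t mu)%E.
    by rewrite /u mule_ge0 ?lee_fin ?mxSobolev_norm_ge0.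
  have v0 k mu : (0 <= v k mu)%E by exact: mxSobolev_norm_ge0.
  have s0 mu : (0 <= \sum_(t < r | (t < j)%N) u t mu)%E.
    by apply: sume_ge0 => t _.
  have sc : (fun mu => \sum_(t < r | (t < j)%N) u t mu)%E @ mu0 --> 0%E.
    apply: (@ge0_cvg_sum0 M (nbhs mu0) _ R 'I_r (index_enum _)
      (fun t : 'I_r => (t < j)%N) u) => // t tj.
    apply: cvge0Z.
    by apply: (IH t) => //; rewrite -js.
  have vc k : (fun mu => v k mu + \sum_(t < r | (t < j)%N) u t mu)%E @ mu0 --> 0%E.
    apply: cvge0D => //.
    by apply: strong; exact: monomial_vector_Sobolev.
  have vs0 k mu : (0 <= v k mu + \sum_(t < r | (t < j)%N) u t mu)%E.
    by rewrite adde_ge0.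
  (* The bound is a double sum over the entries; its summand does not depend on the row index. *)
  apply: (@ge0_cvg_sum0 M (nbhs mu0) _ R 'I_m (index_enum _) xpredT
    (fun _ mu => \sum_(k < m) (v k mu + \sum_(t < r | (t < j)%N) u t mu))%E).
    by move=> _ mu; apply: sume_ge0 => k _.
  move=> _ _; exact: (@ge0_cvg_sum0 M (nbhs mu0) _ R 'I_m (index_enum _) xpredT
    (fun k mu => v k mu + \sum_(t < r | (t < j)%N) u t mu)%E).
Qed.
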